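(* The determinant of the square matrix over $\mathbb Z/2$ represented by a finite directed graph is not computable in $\tilde{C}$PTime. That is, no polynomial time bounded BGS program (without the cardinality function) decides, for every finite directed graph $\langle I,E\rangle$ with $E\subseteq I\times I$, whether the $I$-square matrix $M$ over $\mathbb Z/2$ with $M(i,j)=1\iff(i,j)\in E$ has determinant $1$.
   Context: The determinant of an $I$-square matrix $M:I\times I\to\mathbb Z/2$ is that of the ordinary matrix obtained by choosing any linear ordering of $I$ for both rows and columns (independent of the ordering). $\tilde{C}$PTime is the class of Boolean queries decidable by polynomial time bounded BGS programs: abstract state machine programs operating on the hereditarily finite sets over the input's elements (as atoms), with the input relations, logical operations, set functions $\in,\emptyset,$ Atoms, $\bigcup$, TheUnique, Pair, comprehension terms $\{t(v):v\in r:\varphi(v)\}$, dynamic functions updated by rules built from updates, conditionals and parallel ''do forall'' rules (all updates of a step executed simultaneously unless conflicting), run for at most polynomially many steps with at most polynomially many active elements in the input size; the answer is the value of Output when Halt first becomes true. *)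

(* Defs.v *)
From HB Require Import structures.
From mathcomp Require Import all_boot all_order all_algebra.
From mathcomp Require Import perm generic_quotient finmap.

Set Implicit Arguments.
Unset Strict Implicit.
Unset Printing Implicit Defensive.

Import GRing.Theory.

Local Open Scope fset_scope.

(** * Hereditarily finite sets over a set of atoms *)

(* Well-founded finitely branching trees; [hf I] is their quotient by
   extensional equality (order and repetition of children are forgotten). *)
Inductive hftree (I : Type) : Type :=
  | Leaf of I
  | Node of seq (hftree I).

Section HFTree.
Variable I : choiceType.

Lemma hftree_nested_ind (P : hftree I -> Prop) :
    (forall a, P (Leaf a)) ->
    (forall ts, foldr (fun t Q => P t /\ Q) True ts -> P (Node ts)) ->
  forall t, P t.
Proof.
move=> PL PN; fix IH 1 => -[a|ts]; first exact: PL.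
apply: PN; move: ts; fix IHs 1 => -[|t ts]; first exact: Logic.I.
split; [exact: IH | exact: IHs].
Qed.

Fixpoint hftree_encode (t : hftree I) : GenTree.tree I :=
  match t with
  | Leaf a => GenTree.Leaf a
  | Node ts => GenTree.Node 0 (map hftree_encode ts)
  end.

Fixpoint hftree_decode (t : GenTree.tree I) : hftree I :=
  match t with
  | GenTree.Leaf a => Leaf a
  | GenTree.Node _ ts => Node (map hftree_decode ts)
  end.

Lemma hftree_encodeK : cancel hftree_encode hftree_decode.
Proof.
elim/hftree_nested_ind => //= ts IH; congr Node.
by elim: ts IH => //= t ts IHts [-> /IHts ->].
Qed.

HB.instance Definition _ := Choice.copy (hftree I) (can_type hftree_encodeK).

Lemma hftree_mem_ind (P : hftree I -> Prop) :
    (forall a, P (Leaf a)) ->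
    (forall ts : seq (hftree I), {in ts, forall t, P t} -> P (Node ts)) ->
  forall t, P t.
Proof.
move=> PL PN; elim/hftree_nested_ind => // ts Pts; apply: PN.
elim: ts Pts => //= u ts IHts [Pu /IHts Pts] t.
by rewrite inE => /predU1P[->|/Pts].
Qed.

Fixpoint hfeqv (s t : hftree I) : bool :=
  match s, t with
  | Leaf a, Leaf b => a == b
  | Node ss, Node ts =>
      all (fun s' => has (fun t' => hfeqv s' t') ts) ss
        && all (fun t' => has (fun s' => hfeqv s' t') ss) ts
  | _, _ => false
  end.

Lemma hfeqv_refl : reflexive hfeqv.
Proof.
elim/hftree_mem_ind => [a|ts IH] /=; first exact: eqxx.
by apply/andP; split; apply/allP=> t tts; apply/hasP; exists t; rewrite ?IH.
Qed.

Lemma hfeqv_sym : symmetric hfeqv.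
Proof.
elim/hftree_mem_ind => [a|ss IH] [b|ts] //=.
rewrite andbC; congr (_ && _).
  by apply: eq_all => t; apply: eq_in_has => s /IH ->.
by apply: eq_in_all => s sss; apply: eq_has => t; rewrite IH.
Qed.

Lemma hfeqv_trans : transitive hfeqv.
Proof.
elim/hftree_mem_ind => [b|ts IH] [a|ss] [c|us] //=; first by move/eqP->.
case/andP=> /allP st /allP ts' /andP[/allP tu /allP ut].
apply/andP; split; apply/allP.
- move=> s /st /hasP[t tts e1]; case/hasP: (tu _ tts) => u uus e2.
  by apply/hasP; exists u => //; apply: (IH t).
- move=> u /ut /hasP[t tts e2]; case/hasP: (ts' _ tts) => s sss e1.
  by apply/hasP; exists s => //; apply: (IH t).
Qed.

Canonical hfeqv_equiv := EquivRel hfeqv hfeqv_refl hfeqv_sym hfeqv_trans.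

End HFTree.

Definition hf (I : choiceType) : Type := {eq_quot (@hfeqv_equiv I)}%qT.
HB.instance Definition _ (I : choiceType) :=
  Choice.copy (hf I) {eq_quot (@hfeqv_equiv I)}%qT.
HB.instance Definition _ (I : choiceType) :=
  EqQuotient.copy (hf I) {eq_quot (@hfeqv_equiv I)}%qT.

Section HF.
Variable I : choiceType.
Implicit Types (x y : hf I) (A : {fset hf I}).

Definition hf_class (t : hftree I) : hf I := (\pi_(hf I) t)%qT.
Definition hf_repr x : hftree I := (repr (x : {eq_quot (@hfeqv_equiv I)}%qT))%qT.

Lemma hf_reprK x : hf_class (hf_repr x) = x.
Proof. exact: reprK. Qed.

Lemma hf_classP s t : reflect (hf_class s = hf_class t) (hfeqv s t).
Proof. exact: (@eqquotP _ (@hfeqv_equiv I) (hf I)). Qed.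

Definition atom (a : I) : hf I := hf_class (Leaf a).

Definition mkset A : hf I := hf_class (Node [seq hf_repr x | x <- A]).

(* The elements of a set; an atom has none. *)
Definition elts x : {fset hf I} :=
  match hf_repr x with
  | Leaf _ => fset0
  | Node ts => [fset hf_class t | t in ts]
  end.

Definition hf0 : hf I := mkset fset0.
Definition hf1 : hf I := mkset [fset hf0].

(* Truth values are identified with the ordinals 0 and 1. *)
Definition hfbool (b : bool) : hf I := if b then hf1 else hf0.

Lemma eltsK A : elts (mkset A) = A.
Proof.
rewrite /elts /mkset.
set t := Node _; have : hfeqv t (hf_repr (hf_class t)).
  by apply/hf_classP; rewrite hf_reprK.
rewrite {}/t; case: (hf_repr _) => //= ts /andP[/allP h1 /allP h2].
apply/fsetP=> x; apply/imfsetP/idP => /= [[t tts ->]|xA].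
  case/hasP: (h2 _ tts) => _ /mapP[y yA ->].
  by move/hf_classP; rewrite hf_reprK => <-.
case/hasP: (h1 _ (map_f hf_repr xA)) => t tts.
by move/hf_classP; rewrite hf_reprK => ->; exists t.
Qed.

Lemma elts_atom a : elts (atom a) = fset0.
Proof.
rewrite /elts /atom.
have : hfeqv (Leaf a) (hf_repr (hf_class (Leaf a))).
  by apply/hf_classP; rewrite hf_reprK.
by case: (hf_repr _).
Qed.

Lemma atom_inj : injective atom.
Proof. by move=> a b /hf_classP /eqP. Qed.

Lemma mkset_inj : injective mkset.
Proof. exact: can_inj eltsK. Qed.

Lemma atom_neq_mkset a A : atom a != mkset A.
Proof. by apply/negP=> /eqP /hf_classP. Qed.

Lemma hf_class_Node (ts : seq (hftree I)) :
  hf_class (Node ts) = mkset [fset hf_class t | t in ts].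
Proof.
apply/hf_classP => /=; apply/andP; split; apply/allP.
  move=> t tts; apply/hasP; exists (hf_repr (hf_class t)).
    by apply: map_f; apply/imfsetP; exists t.
  by apply/hf_classP; rewrite hf_reprK.
move=> _ /mapP[x /imfsetP[/= t tts ->] ->]; apply/hasP; exists t => //.
by apply/hf_classP; rewrite hf_reprK.
Qed.

Lemma hf_ind (P : hf I -> Prop) :
    (forall a, P (atom a)) ->
    (forall A, {in A, forall x, P x} -> P (mkset A)) ->
  forall x, P x.
Proof.
move=> Pa Ps x; rewrite -[x]hf_reprK.
elim/hftree_mem_ind: (hf_repr x) => // ts IH.
by rewrite hf_class_Node; apply: Ps => _ /imfsetP[/= t tts ->]; apply: IH.
Qed.

(* [in_tc x z] : x belongs to TC(z), the least transitive set with z as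
   a member. *)
Inductive in_tc x : hf I -> Prop :=
  | in_tc_refl : in_tc x x
  | in_tc_step y z : y \in elts z -> in_tc x y -> in_tc x z.

Definition hf_union x : hf I := mkset (\bigcup_(y <- elts x) elts y).

Definition hf_pair x y : hf I := mkset [fset x; y].

Definition hf_the_unique x : hf I :=
  if enum_fset (elts x) is [:: y] then y else hf0.

End HF.

Definition hf_atoms (I : finType) : hf I := mkset [fset atom a | a in I].

(** * Vocabularies and input structures *)

Record vocab := Vocab { sym :> finType; arity : sym -> nat }.

Definition structure (V : vocab) (I : finType) :=
  forall R : V, pred ((arity R).-tuple I).

(** * Syntax of BGS programs *)

Section Syntax.
(* input relations, dynamic functions, dynamic relations *)
Variables (V F P : vocab).

(* Variables are de Bruijn indices: [term k] and [bterm k] are the terms and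
   the Boolean terms whose free variables are among [k] given ones.  The
   variable bound by [Compr t r g], that is {t(v) : v in r : g(v)}, is index 0
   of [t] and [g], and is not free in [r]. *)
Inductive term (k : nat) : Type :=
  | Var of 'I_k
  | EmptySet
  | Atoms
  | Union of term k
  | TheUnique of term k
  | Pair of term k & term k
  | DynFun (f : F) of ('I_(arity f) -> term k)
  | Compr of term k.+1 & term k & bterm k.+1
  | OfBool of bterm k
with bterm (k : nat) : Type :=
  | TrueB
  | FalseB
  | NotB of bterm k
  | AndB of bterm k & bterm k
  | OrB of bterm k & bterm k
  | Equal of term k & term k
  | Mem of term k & term k
  | Input (R : V) of ('I_(arity R) -> term k)
  | DynRel (p : P) of ('I_(arity p) -> term k).

(* [Forall r R] is "do forall v in r, R(v)", with v index 0 of [R]. *)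
Inductive rule (k : nat) : Type :=
  | Skip
  | UpdateFun (f : F) of ('I_(arity f) -> term k) & term k
  | UpdateRel (p : P) of ('I_(arity p) -> term k) & bterm k
  | Cond of bterm k & rule k & rule k
  | Forall of term k & rule k.+1.

End Syntax.

Arguments Var {V F P k}.
Arguments EmptySet {V F P k}.
Arguments Atoms {V F P k}.
Arguments TrueB {V F P k}.
Arguments FalseB {V F P k}.
Arguments Skip {V F P k}.

Record program (V : vocab) := Program {
  dynfun : vocab;
  dynrel : vocab;
  Halt : dynrel;
  Output : dynrel;
  arity_Halt : arity Halt = 0;
  arity_Output : arity Output = 0;
  Halt_neq_Output : Halt != Output;
  body : rule V dynfun dynrel 0
}.

(** * Semantics *)

Section Semantics.
Variables (V F P : vocab) (I : finType) (A : structure V I).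

(* A dynamic symbol with its arguments; only argument lists of length the
   arity of the symbol are ever read or written. *)
Definition location : choiceType := ((F + P) * seq (hf I))%type.

(* The dynamic part of a state.  All but finitely many locations have the
   default value 0 = false. *)
Definition state := {fsfun location -> hf I of l => hf0 I}.

Definition init_state : state := [fsfun of l => hf0 I].

Definition input_holds (R : V) (xs : seq (hf I)) : bool :=
  [exists a : (arity R).-tuple I, A a && (xs == map (@atom I) a)].

Fixpoint eval (s : state) k (e : k.-tuple (hf I)) (t : term V F P k) : hf I :=
  match t with
  | Var i => tnth e i
  | EmptySet => hf0 I
  | Atoms => hf_atoms I
  | Union t => hf_union (eval s e t)
  | TheUnique t => hf_the_unique (eval s e t)
  | Pair t u => hf_pair (eval s e t) (eval s e u)
  | DynFun f ts => s (inl f, [seq eval s e (ts i) | i <- enum 'I_(arity f)])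
  | Compr t r g =>
      mkset [fset eval s (cons_tuple x e) t
            | x in [fset y in elts (eval s e r)
                   | beval s (cons_tuple y e) g]]
  | OfBool g => hfbool I (beval s e g)
  end
with beval (s : state) k (e : k.-tuple (hf I)) (g : bterm V F P k) : bool :=
  match g with
  | TrueB => true
  | FalseB => false
  | NotB g => ~~ beval s e g
  | AndB g h => beval s e g && beval s e h
  | OrB g h => beval s e g || beval s e h
  | Equal t u => eval s e t == eval s e u
  | Mem t u => eval s e t \in elts (eval s e u)
  | Input R ts => input_holds R [seq eval s e (ts i) | i <- enum 'I_(arity R)]
  | DynRel p ts =>
      s (inr p, [seq eval s e (ts i) | i <- enum 'I_(arity p)]) == hf1 I
  end.

Definition update : choiceType := (location * hf I)%type.

Fixpoint updates (s : state) k (e : k.-tuple (hf I)) (R : rule V F P k) :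
    {fset update} :=
  match R with
  | Skip => fset0
  | UpdateFun f ts t =>
      [fset ((inl f, [seq eval s e (ts i) | i <- enum 'I_(arity f)]),
             eval s e t) : update]
  | UpdateRel p ts g =>
      [fset ((inr p, [seq eval s e (ts i) | i <- enum 'I_(arity p)]),
             hfbool I (beval s e g)) : update]
  | Cond g R1 R2 => if beval s e g then updates s e R1 else updates s e R2
  | Forall r R1 =>
      \bigcup_(x <- elts (eval s e r)) updates s (cons_tuple x e) R1
  end.

Definition consistent (D : {fset update}) : bool :=
  all2rel (fun u v : update => (u.1 == v.1) ==> (u.2 == v.2)) D.

(* For consistent [D] there is at most one new value at each location. *)
Definition fire (s : state) (D : {fset update}) : state :=
  [fsfun l in finsupp s `|` [fset u.1 | u in D]
   => head (s l) [seq u.2 | u <- D & u.1 == l] | hf0 I].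

(* A step with conflicting updates leaves the state unchanged. *)
Definition step (R : rule V F P 0) (s : state) : state :=
  let D := updates s [tuple] R in if consistent D then fire s D else s.

Definition run (R : rule V F P 0) (i : nat) : state := iter i (step R) init_state.

Variant critical (s : state) : hf I -> Prop :=
  | critical_atom a : critical s (atom a)
  | critical_bool b : critical s (hfbool I b)
  | critical_val l : l \in finsupp s -> critical s (s l)
  | critical_arg l x : l \in finsupp s -> x \in l.2 -> critical s x.

Definition active (s : state) (x : hf I) : Prop :=
  exists2 y, critical s y & in_tc x y.

End Semantics.

(** * Polynomial time bounded programs and the class of queries they decide *)

Record bounded_program (V : vocab) := BoundedProgram {
  prog :> program V;
  time_bound : {poly nat};
  active_bound : {poly nat}
}.

(* The run first reaches a state with Halt true after [m] steps, within the
   time bound; at most [active_bound] elements are active in its states up to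
   then; and Output has the value [b] in that state. *)
Definition answers (V : vocab) (B : bounded_program V)
    (I : finType) (A : structure V I) (b : bool) : Prop :=
  exists m : nat,
    [/\ (m <= (time_bound B).[#|I|]%R)%N,
        run A (body B) m (inr (Halt B), [::]) = hf1 I,
        forall i, (i < m)%N ->
          run A (body B) i (inr (Halt B), [::]) <> hf1 I,
        exists2 X : {fset hf I}, (#|` X| <= (active_bound B).[#|I|]%R)%N
          & forall i x, (i <= m)%N -> active (run A (body B) i) x -> x \in X
      & run A (body B) m (inr (Output B), [::]) = hfbool I b].

Definition query (V : vocab) := forall I : finType, structure V I -> bool.

Definition decides (V : vocab) (B : bounded_program V) (Q : query V) : Prop :=
  forall (I : finType) (A : structure V I), answers B A (Q I A).

Definition CPTime (V : vocab) (Q : query V) : Prop :=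
  exists B : bounded_program V, decides B Q.

(** * Determinants of matrices indexed by a finite set *)

Definition idet (K : comNzRingType) (I : finType) (M : I -> I -> K) : K :=
  (\det (\matrix_(i < #|I|, j < #|I|) M (enum_val i) (enum_val j)))%R.

Lemma idet_order (K : comNzRingType) (I : finType) (M : I -> I -> K)
    (n : nat) (e : 'I_n -> I) :
  bijective e -> (\det (\matrix_(i < n, j < n) M (e i) (e j)))%R = idet M.
Proof.
move=> be; have En : n = #|I| by rewrite -(bij_eq_card be) card_ord.
subst n; have inj : injective (fun i => enum_rank (e i)).
  by move=> i j /enum_rank_inj /(bij_inj be).
pose s := perm inj.
rewrite /idet; set N := (\matrix_(i, j) M (enum_val i) (enum_val j))%R.
have -> : (\matrix_(i, j) M (e i) (e j))%R = row_perm s (col_perm s N).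
  by apply/matrixP=> i j; rewrite !mxE !permE !enum_rankK.
rewrite row_permE col_permE !det_mulmx !det_perm mulrCA -signr_addb.
by rewrite odd_permV addbb mulr1.
Qed.

(** * Directed graphs *)

Definition digraph_vocab : vocab := @Vocab unit (fun=> 2).

Definition edge (I : finType) (G : structure digraph_vocab I) (i j : I) : bool :=
  G tt [tuple i; j].

Definition adj_mod2 (I : finType) (G : structure digraph_vocab I) (i j : I) :
  'F_2 := ((edge G i j)%:R)%R.

Definition det_query : query digraph_vocab :=
  fun I G => idet (adj_mod2 G) == 1%R.

(* Main.v *)
From mathcomp Require Import all_boot all_order all_algebra.
From mathcomp Require Import perm finmap.
From mathcomp Require Import zify.
Require Import Defs.

Set Implicit Arguments.
Unset Strict Implicit.
Unset Printing Implicit Defensive.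

Local Open Scope fset_scope.

(* The adjacency matrix of the loopless complete graph on n vertices is J - 1,
   whose determinant mod 2 is 1 exactly when n is even; so it suffices that no
   program tells the complete graphs on n and n + 1 vertices apart, n large.

   A state of the run is invariant under all permutations of the atoms and has
   only polynomially many active elements, so a counting argument gives every
   active element a support of bounded size c.  Intermediate values computed
   from hereditarily c-supported sets are hereditarily M-supported, for some M
   depending only on the program.  Over two atom sets I and J that are large
   compared with M, every partial bijection th between I and J induces a map
   [transfer M th] from sets over I to sets over J, which on hereditarily
   M-supported sets whose support lies in the domain of th is a membership
   isomorphism that does not depend on th outside of the support.  Evaluation
   of terms and rules commutes with it, so both runs halt at the same step with
   the same output. *)

(** * Permutations acting on hereditarily finite sets *)

(** The atom sets have different sizes, so the two inputs are not isomorphic; what remains is a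
    back-and-forth along small partial bijections, which sees a set only through a small support.
    Two quantities could degrade along a run whose length depends on the input. Support sizes:
    evaluating a rule raises them from [c] to [M], but what a step stores is active in the next
    state, where the counting argument applies afresh and gives [c] again. Spare atoms: nested
    binders use them up, but a stored value is supported by any common support of the arguments of
    its location, so before the next step the partial bijection can be exchanged for one whose size
    is bounded through the arities. Intermediate values need not be active, and the polynomial bound
    says nothing about them; their supports come from the environment, since a permutation that
    fixes the variables and leaves the state invariant fixes the value of a term. *)

Lemma hfP (I : choiceType) (x : hf I) :
  (exists a, x = atom a) \/ (exists A, x = mkset A).
Proof. by elim/hf_ind: x => [a|A _]; [left; exists a | right; exists A]. Qed.

Section Hfmap.
Variables I J : choiceType.
Implicit Types f : I -> J.

Fixpoint tree_map f (t : hftree I) : hftree J :=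
  match t with
  | Leaf a => Leaf (f a)
  | Node ts => Node (map (tree_map f) ts)
  end.

Lemma tree_map_eqv f s t : hfeqv s t -> hfeqv (tree_map f s) (tree_map f t).
Proof.
elim/hftree_mem_ind: s t => [a|ss IH] [b|ts] //=; first by move/eqP->.
case/andP=> /allP st /allP ts'; apply/andP; split; apply/allP.
- move=> _ /mapP[s sss ->]; case/hasP: (st _ sss) => t tts e.
  by apply/hasP; exists (tree_map f t); [apply: map_f | apply: IH].
- move=> _ /mapP[t tts ->]; case/hasP: (ts' _ tts) => s sss e.
  by apply/hasP; exists (tree_map f s); [apply: map_f | apply: IH].
Qed.

Definition hfmap f (x : hf I) : hf J := hf_class (tree_map f (hf_repr x)).

Lemma hfmap_class f t : hfmap f (hf_class t) = hf_class (tree_map f t).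
Proof. by apply/hf_classP/tree_map_eqv/hf_classP; rewrite hf_reprK. Qed.

Lemma hfmap_atom f a : hfmap f (atom a) = atom (f a).
Proof. by rewrite /atom hfmap_class. Qed.

Lemma hfmap_mkset f A : hfmap f (mkset A) = mkset [fset hfmap f x | x in A].
Proof.
rewrite {1}/mkset hfmap_class /= hf_class_Node; congr mkset.
apply/fsetP => y; apply/imfsetP/imfsetP => /= [[t]|[x xA ->]].
  by rewrite -map_comp => /mapP[x xA ->] ->; exists x.
exists (tree_map f (hf_repr x)) => //=; rewrite -map_comp.
exact: (map_f (tree_map f \o @hf_repr I)).
Qed.

Lemma elts_hfmap f x : elts (hfmap f x) = [fset hfmap f y | y in elts x].
Proof.
case: (hfP x) => [[a ->]|[A ->]].
  by rewrite hfmap_atom !elts_atom; apply/fsetP => y; rewrite !inE; apply/esym/imfsetP => -[].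
by rewrite hfmap_mkset !eltsK.
Qed.

End Hfmap.

Lemma eq_hfmap (I J : choiceType) (f g : I -> J) : f =1 g -> hfmap f =1 hfmap g.
Proof.
move=> fg; elim/hf_ind => [a|A IH]; first by rewrite !hfmap_atom fg.
by rewrite !hfmap_mkset; congr mkset; apply: eq_in_imfset.
Qed.

Lemma hfmap_id (I : choiceType) : @hfmap I I id =1 id.
Proof.
elim/hf_ind => [a|A IH]; first by rewrite !hfmap_atom.
rewrite !hfmap_mkset; congr mkset; apply/fsetP => y; apply/imfsetP/idP => /= [[x xA ->]|yA].
  by rewrite IH.
by exists y => //; rewrite IH.
Qed.

Lemma hfmap_comp (I J K : choiceType) (g : J -> K) (f : I -> J) x :
  hfmap g (hfmap f x) = hfmap (g \o f) x.
Proof.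
elim/hf_ind: x => [a|A IH]; first by rewrite !hfmap_atom.
rewrite !hfmap_mkset; congr mkset; apply/fsetP => y.
apply/imfsetP/imfsetP => /= [[_ /imfsetP[/= x xA ->] ->]|[x xA ->]].
  by exists x; rewrite ?IH.
by exists (hfmap f x); rewrite ?IH //; apply/imfsetP; exists x.
Qed.

(** * Supports of hereditarily finite sets *)

Section Support.
Variable I : finType.
Implicit Types (s t : {perm I}) (x : hf I) (S : {set I}).

Lemma hfmap1 x : hfmap (1%g : {perm I}) x = x.
Proof. by rewrite -[RHS]hfmap_id; apply: eq_hfmap => a; rewrite perm1. Qed.

Lemma hfmapM s t x : hfmap (s * t)%g x = hfmap t (hfmap s x).
Proof. by rewrite hfmap_comp; apply: eq_hfmap => a; rewrite permM. Qed.

Lemma hfmapK s : cancel (hfmap s) (hfmap s^-1%g).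
Proof. by move=> x; rewrite -hfmapM mulgV hfmap1. Qed.

Lemma hfmapKV s : cancel (hfmap s^-1%g) (hfmap s).
Proof. by move=> x; rewrite -hfmapM mulVg hfmap1. Qed.

Lemma hfmap_inj s : injective (hfmap s).
Proof. exact: can_inj (hfmapK s). Qed.

Lemma hfmap_tpermK (a b : I) : involutive (hfmap (tperm a b)).
Proof. by move=> x; rewrite -hfmapM tperm2 hfmap1. Qed.

Lemma mem_elts_hfmap s x y : (hfmap s y \in elts (hfmap s x)) = (y \in elts x).
Proof. by rewrite elts_hfmap mem_imfset //=; apply: hfmap_inj. Qed.

(* Only transpositions are quantified over, which keeps [supp] boolean;
   [supp_perm] gives all permutations fixing [S] pointwise. *)
Definition supp S x : bool :=
  [forall a, forall b, (a \notin S) ==> (b \notin S) ==> (hfmap (tperm a b) x == x)].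

Lemma suppP S x :
  reflect (forall a b, a \notin S -> b \notin S -> hfmap (tperm a b) x = x) (supp S x).
Proof.
apply: (iffP forallP) => [H a b aS bS|H a].
  by have /forallP/(_ b) := H a; rewrite aS bS => /eqP.
by apply/forallP => b; apply/implyP => aS; apply/implyP => bS; rewrite H.
Qed.

(** Induction on the number of moved points: if [s] moves [a], then neither [a] nor [s a] lies in
    [S], and composing [s] with the transposition of the two fixes [a] and moves no new point. *)
Lemma supp_perm S x s : supp S x -> {in S, forall a, s a = a} -> hfmap s x = x.
Proof.
move=> /suppP Sx; have [n] := ubnP #|[pred a | s a != a]|.
elim: n s => // n IH s; rewrite ltnS => le sS.
have [/forallP s1|] := boolP [forall a, s a == a].
  have ->: s = 1%g by apply/permP => a; rewrite perm1; apply/eqP.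
  by rewrite hfmap1.
rewrite negb_forall => /existsP[a sa].
have aS : a \notin S by apply: contra sa => /sS ->.
have saS : s a \notin S.
  by apply: contra sa => /sS /perm_inj ->.
rewrite -[s](mulgK (tperm a (s a))) tpermV hfmapM IH ?Sx //.
  apply: leq_trans le; apply: proper_card; apply/properP; split.
    apply/subsetP => b; rewrite !inE permM; case: tpermP => [eb|/perm_inj->|_ _] //.
    by rewrite eb => _; apply: contraNneq sa => ab; rewrite {1}ab eb.
  by exists a; rewrite !inE // permM tpermR eqxx.
move=> b bS; rewrite permM (sS b) // tpermD //.
  by apply: contraNneq aS => ->.
by apply: contraNneq saS => ->.
Qed.

Lemma supp_sub S S' x : S \subset S' -> supp S x -> supp S' x.
Proof.
move=> /subsetP sS /suppP Sx; apply/suppP => a b aS bS.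
by apply: Sx; [apply: contra aS|apply: contra bS]; apply: sS.
Qed.

Lemma supp_map s S x : supp S x -> supp (s @: S) (hfmap s x).
Proof.
move=> /suppP Sx; apply/suppP => a b; rewrite -[a](permKV s) -[b](permKV s).
rewrite !(mem_imset _ _ (@perm_inj _ s)) => aS bS.
by rewrite -tpermJ -!hfmapM conjgE !mulgA mulgV mul1g hfmapM Sx.
Qed.

Lemma supp_mapE s S x : supp (s @: S) (hfmap s x) = supp S x.
Proof.
apply/idP/idP => [/(supp_map s^-1%g)|]; last exact: supp_map.
rewrite hfmapK -imset_comp (eq_imset (g := id)) ?imset_id // => a /=.
by rewrite permK.
Qed.

(** A point [c] outside both supports exists because their union is proper. For [a] outside [S1] and
    [b] outside [S2], the transposition (a b) is the conjugate of (b c) by (a c); the former fixes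
    [x] by [S2] and the latter by [S1]. *)
Lemma supp_capl S1 S2 x : S1 :|: S2 != setT -> supp S1 x -> supp S2 x ->
  supp (S1 :&: S2) x.
Proof.
rewrite -subTset => /subsetPn[c _]; rewrite !inE negb_or => /andP[c1 c2].
move=> /suppP H1 /suppP H2.
have key a b : a \notin S1 -> b \notin S2 -> a != c -> b != c -> a != b -> hfmap (tperm a b) x = x.
  move=> a1 b2 ac bc ab.
  have -> : (tperm a b = tperm b c ^ tperm a c)%g.
    by rewrite tpermJ tpermR tpermD // 1?eq_sym // tpermC.
  rewrite conjgE tpermV.
  by rewrite !hfmapM H1 // H2 // H1.
apply/suppP => a b; rewrite !inE !negb_and => aS bS.
have [->|ab] := eqVneq a b; first by rewrite tperm1 hfmap1.
have [ac|ac] := eqVneq a c.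
  by subst c; case/orP: bS => ?; [apply: H1|apply: H2].
have [bc|bc] := eqVneq b c.
  by subst c; case/orP: aS => ?; [apply: H1|apply: H2].
case/orP: aS => aS; case/orP: bS => bS; [exact: H1|exact: key| |exact: H2].
by rewrite tpermC; apply: key => //; rewrite eq_sym.
Qed.

Lemma supp_atom S a : a \in S -> supp S (atom a).
Proof.
move=> aS; apply/suppP => b c bS cS; rewrite hfmap_atom tpermD //.
  by apply: contraNneq bS => ->.
by apply: contraNneq cS => ->.
Qed.

(** If [a] were outside [S], the strict inequality would supply a second atom outside [S] with which
    a transposition exchanges it. *)
Lemma supp_atom_in S a : (#|S|.+1 < #|I|)%N -> supp S (atom a) -> a \in S.
Proof.
move=> lt /suppP H; apply: contraTT lt => aS; rewrite -leqNgt.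
have : [set: I] \subset a |: S.
  apply/subsetP => b _; rewrite !inE; apply: contraT; rewrite negb_or => /andP[ba bS].
  have /atom_inj := etrans (esym (hfmap_atom _ _)) (H _ _ aS bS).
  by rewrite tpermL => eba; rewrite eba eqxx in ba.
move/subset_leq_card; rewrite cardsT => /leq_trans; apply.
by rewrite cardsU1; case: (_ \in _).
Qed.

End Support.

(** * Partial bijections *)

Section PartialBijections.
Variables I J : finType.
Implicit Types (th : {set I * J}) (s : {perm I}) (t : {perm J}).

(** A partial bijection is a finite set of pairs, so that all of them can be enumerated in the
    definition of the transfer. The condition combines single-valuedness and injectivity and is
    symmetric under inversion. *)
Definition pbij th : bool :=
  [forall p in th, forall q in th, (p.1 == q.1) == (p.2 == q.2)].

Definition dom th : {set I} := [set p.1 | p in th].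
Definition ran th : {set J} := [set p.2 | p in th].
Definition pact s t th : {set I * J} :=
  [set p | ((s^-1)%g p.1, (t^-1)%g p.2) \in th].

Lemma pbijP th :
  reflect (forall i j i' j', (i, j) \in th -> (i', j') \in th -> (i == i') = (j == j'))
          (pbij th).
Proof.
apply: (iffP forall_inP) => [H i j i' j' ij ij'|H [i j] ij].
  by have /forall_inP/(_ _ ij')/eqP := H _ ij.
by apply/forall_inP => -[i' j'] ij' /=; rewrite (H i j i' j').
Qed.

Lemma domP th i : reflect (exists j, (i, j) \in th) (i \in dom th).
Proof.
apply: (iffP imsetP) => [[[i' j] ij /= ->]|[j ij]]; first by exists j.
by exists (i, j).
Qed.

Lemma ranP th j : reflect (exists i, (i, j) \in th) (j \in ran th).
Proof.
apply: (iffP imsetP) => [[[i j'] ij /= ->]|[i ij]]; first by exists i.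
by exists (i, j).
Qed.

Lemma mem_dom th i j : (i, j) \in th -> i \in dom th.
Proof. by move=> ij; apply/domP; exists j. Qed.

Lemma mem_ran th i j : (i, j) \in th -> j \in ran th.
Proof. by move=> ij; apply/ranP; exists i. Qed.

Lemma domU th th' : dom (th :|: th') = dom th :|: dom th'.
Proof. exact: imsetU. Qed.

Lemma ranU th th' : ran (th :|: th') = ran th :|: ran th'.
Proof. exact: imsetU. Qed.

Lemma dom_sub th th' : th \subset th' -> dom th \subset dom th'.
Proof. exact: imsetS. Qed.

Lemma pbij_sub th th' : th \subset th' -> pbij th' -> pbij th.
Proof.
move=> /subsetP sth /pbijP H; apply/pbijP => i j i' j' ij ij'.
by apply: H; apply: sth.
Qed.

Lemma pbijUr th th' : pbij (th :|: th') -> pbij th'.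
Proof. exact: pbij_sub (subsetUr _ _). Qed.

Lemma card_dom th : pbij th -> #|dom th| = #|th|.
Proof.
move=> /pbijP H; apply: card_in_imset => -[i j] [i' j'] ij ij' /= e.
by have /esym := H _ _ _ _ ij ij'; rewrite e eqxx => /eqP ->.
Qed.

Lemma card_ran th : pbij th -> #|ran th| = #|th|.
Proof.
move=> /pbijP H; apply: card_in_imset => -[i j] [i' j'] ij ij' /= e.
by have := H _ _ _ _ ij ij'; rewrite e eqxx => /eqP ->.
Qed.

Lemma card_dom_le th : (#|dom th| <= #|th|)%N.
Proof. exact: leq_imset_card. Qed.

Lemma mem_pact s t th i j : ((s i, t j) \in pact s t th) = ((i, j) \in th).
Proof. by rewrite inE /= !permK. Qed.

Lemma pactP s t th p :
  reflect (exists i j, (i, j) \in th /\ p = (s i, t j)) (p \in pact s t th).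
Proof.
apply: (iffP idP) => [|[i [j [ij ->]]]]; last by rewrite mem_pact.
case: p => i j; rewrite inE => ij; exists ((s^-1)%g i), ((t^-1)%g j).
by rewrite !permKV.
Qed.

Lemma pactU s t th th' : pact s t (th :|: th') = pact s t th :|: pact s t th'.
Proof. by apply/setP => p; rewrite !inE. Qed.

Lemma pactKV s t : cancel (pact s^-1 t^-1) (pact s t).
Proof. by move=> th; apply/setP => -[i j]; rewrite !inE /= !permK. Qed.

Lemma dom_pact s t th : dom (pact s t th) = s @: dom th.
Proof.
apply/setP => i; apply/domP/imsetP => [[j /pactP[i' [j' [ij [-> _]]]]]|[i' /domP[j ij] ->]].
  by exists i' => //; apply: mem_dom ij.
by exists (t j); rewrite mem_pact.
Qed.

Lemma pbij_pact s t th : pbij (pact s t th) = pbij th.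
Proof.
apply/pbijP/pbijP => H i j i' j'; last first.
  by rewrite !inE => /H{}H /H; rewrite !(inj_eq perm_inj).
by have := H (s i) (t j) (s i') (t j'); rewrite !mem_pact !(inj_eq perm_inj).
Qed.

Lemma card_pact s t th : #|pact s t th| = #|th|.
Proof.
have <- : [set (s p.1, t p.2) | p in th] = pact s t th.
  apply/setP => p; apply/imsetP/pactP => [[[i j] ij ->]|[i [j [ij ->]]]].
    by exists i, j.
  by exists (i, j).
by apply: card_imset => -[i j] [i' j'] /= [/perm_inj -> /perm_inj ->].
Qed.

Lemma pact_fix s t th :
  {in dom th, forall i, s i = i} -> {in ran th, forall j, t j = j} -> pact s t th = th.
Proof.
move=> sd tr; apply/setP => -[i j]; apply/pactP/idP => [[i' [j' [ij [-> ->]]]]|ij].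
  by rewrite sd ?(mem_dom ij) // tr ?(mem_ran ij).
by exists i, j; rewrite sd ?(mem_dom ij) // tr ?(mem_ran ij).
Qed.

Lemma pbij_add th i j : pbij th -> i \notin dom th -> j \notin ran th -> pbij ((i, j) |: th).
Proof.
move=> /pbijP H id jr; apply/pbijP => a b a' b'; rewrite !inE.
move=> /orP[/eqP[-> ->]|ab] /orP[/eqP[-> ->]|ab']; rewrite ?eqxx ?(H _ _ _ _ ab ab') //.
  have /negPf -> : i != a' by apply: contraNneq id => ->; apply: mem_dom ab'.
  by apply/esym/negbTE; apply: contraNneq jr => ->; apply: mem_ran ab'.
have /negPf -> : a != i by apply: contraNneq id => <-; apply: mem_dom ab.
by apply/esym/negbTE; apply: contraNneq jr => <-; apply: mem_ran ab.
Qed.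

(** Missing elements of [S] are added one at a time, each paired with an atom of [I] not yet in the
    domain; the size bound guarantees that one is left. *)
Lemma pbij_extend_ran th (S : {set J}) :
    pbij th -> (#|ran th :|: S| <= #|I|)%N ->
  exists th', [/\ th \subset th', pbij th' & ran th' = ran th :|: S].
Proof.
have [n] := ubnP #|S :\: ran th|; elim: n th => // n IH th; rewrite ltnS => le bth leI.
have [sS|/subsetPn[j jS jr]] := boolP (S \subset ran th).
  by exists th; rewrite (setUidPl sS).
have : (#|dom th| < #|I|)%N.
  rewrite (card_dom bth) -(card_ran bth); apply: leq_trans leI; apply: proper_card.
  by apply/properP; split; [apply: subsetUl|exists j; rewrite // inE jS orbT].
move=> ltI; have /subsetPn[i _ id] : ~~ ([set: I] \subset dom th).
  by apply: contraTN ltI => /subset_leq_card; rewrite cardsT -leqNgt.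
have r' : ran ((i, j) |: th) = j |: ran th by rewrite ranU /ran imset_set1.
have [||th' [s' b' e']] := IH ((i, j) |: th) _ (pbij_add bth id jr).
- rewrite r'; apply: leq_trans le; apply: proper_card; apply/properP; split.
    by apply/subsetP => b; rewrite !inE negb_or => /andP[/andP[_ ->] ->].
  by exists j; rewrite !inE ?eqxx ?jS ?jr.
- rewrite r'; apply: leq_trans leI; apply: subset_leq_card.
  by apply/subsetP => b; rewrite !inE => /orP[/orP[/eqP->|->]|->] //; rewrite ?jS ?orbT.
exists th'; split=> //; first by apply: subset_trans s'; apply: subsetUr.
rewrite e' r'; apply/setP => b; rewrite !inE -orbA; case: eqP => [->|//].
by rewrite jS orbT.
Qed.

End PartialBijections.

(** * Inverses and extensions of partial bijections *)

Section InversePartialBijections.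
Variables I J : finType.
Implicit Types th : {set I * J}.

Definition pinv th : {set J * I} := [set p | (p.2, p.1) \in th].

Lemma mem_pinv th i j : ((j, i) \in pinv th) = ((i, j) \in th).
Proof. by rewrite inE. Qed.

Lemma pbij_pinv th : pbij (pinv th) = pbij th.
Proof.
apply/pbijP/pbijP => H i j i' j'; last by rewrite !inE => /H{}H /H.
by move=> ij ij'; have := H j i j' i'; rewrite !mem_pinv => ->.
Qed.

Lemma pinvU th th' : pinv (th :|: th') = pinv th :|: pinv th'.
Proof. by apply/setP => p; rewrite !inE. Qed.

Lemma dom_pinv th : dom (pinv th) = ran th.
Proof. by apply/setP => j; apply/domP/ranP => -[i]; rewrite ?mem_pinv => ij; exists i; rewrite ?mem_pinv. Qed.

Lemma ran_pinv th : ran (pinv th) = dom th.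
Proof. by apply/setP => j; apply/ranP/domP => -[i]; rewrite ?mem_pinv => ij; exists i; rewrite ?mem_pinv. Qed.

Lemma card_pinv th : #|pinv th| = #|th|.
Proof.
have <- : [set (p.2, p.1) | p in th] = pinv th.
  apply/setP => -[j i]; rewrite mem_pinv; apply/imsetP/idP => [[[i' j'] ij [-> ->]] //|ij].
  by exists (i, j).
by apply: card_imset => -[i j] [i' j'] /= [-> ->].
Qed.

Lemma pinv_pact s t th : pinv (pact s t th) = pact t s (pinv th).
Proof. by apply/setP => -[j i]; rewrite !inE. Qed.

End InversePartialBijections.

Lemma pinvK (I J : finType) : cancel (@pinv I J) (@pinv J I).
Proof. by move=> th; apply/setP => -[i j]; rewrite !inE. Qed.

Lemma pinv_sub (I J : finType) (th th' : {set I * J}) :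
  th \subset th' -> pinv th \subset pinv th'.
Proof. by move=> /subsetP sth; apply/subsetP => -[j i]; rewrite !inE; apply: sth. Qed.

Lemma pbij_extend_dom (I J : finType) (th : {set I * J}) (S : {set I}) :
    pbij th -> (#|dom th :|: S| <= #|J|)%N ->
  exists th' : {set I * J}, [/\ th \subset th', pbij th' & dom th' = dom th :|: S].
Proof.
rewrite -pbij_pinv -ran_pinv => bth le.
have [th' [sth b' r']] := pbij_extend_ran bth le.
exists (pinv th'); rewrite pbij_pinv dom_pinv b' r'; split=> //.
by rewrite -[th]pinvK pinv_sub.
Qed.

(** The part [th'] above [S] is kept apart from [th]: its size depends on [S] alone, however large
    [th] is. *)
Lemma pbij_cover_dom (I J : finType) (th : {set I * J}) (S : {set I}) :
    pbij th -> (#|th| + #|S| <= #|J|)%N ->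
  exists th' : {set I * J}, [/\ pbij (th :|: th'), dom th' = S & #|th'| = #|S|].
Proof.
move=> bth le; have [|th2 [s2 b2 d2]] := @pbij_extend_dom _ _ th S bth.
  by apply: leq_trans le; rewrite cardsU card_dom // leq_subr.
have s' : th :|: [set p in th2 | p.1 \in S] \subset th2.
  by rewrite subUset s2; apply/subsetP => p; rewrite inE => /andP[].
have e' : dom [set p in th2 | p.1 \in S] = S.
  apply/setP => i; apply/domP/idP => [[j]|iS]; first by rewrite inE => /andP[].
  have /domP[j ij] : i \in dom th2 by rewrite d2 inE iS orbT.
  by exists j; rewrite inE ij.
exists [set p in th2 | p.1 \in S]; split=> //; first exact: pbij_sub b2.
by rewrite -card_dom ?e' //; apply: pbij_sub b2; apply: subset_trans s'; apply: subsetUr.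
Qed.

Lemma pbij_perm (I : finType) (th : {set I * I}) :
  pbij th -> exists s : {perm I}, forall i j, (i, j) \in th -> s i = j.
Proof.
move=> bth; have [|th' [sth b' r']] := @pbij_extend_ran _ _ th setT bth.
  exact: max_card.
have dT : dom th' = setT.
  by apply/eqP; rewrite eqEcard subsetT (card_dom b') -(card_ran b') r' setUT leqnn.
pose f i := odflt i [pick j | (i, j) \in th'].
have fE i : (i, f i) \in th'.
  rewrite /f; case: pickP => [j //|ij0].
  have /domP[j ij] : i \in dom th' by rewrite dT.
  by have := ij0 j; rewrite ij.
have f_inj : injective f.
  move=> i i' e; have := pbijP _ b' _ _ _ _ (fE i) (fE i').
  by rewrite e eqxx => /eqP.
exists (perm f_inj) => i j /(subsetP sth) ij; rewrite permE.
by have := pbijP _ b' _ _ _ _ (fE i) ij; rewrite eqxx => /esym/eqP.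
Qed.

(** [th1] agrees with [th] but may conflict with the rest of [th']. Extend [th'] to [th2] so that
    the range of [th1] is covered. Following [th :|: th1] and then the inverse of [th2] is a partial
    bijection of [I] that is the identity on [dom th]; any permutation extending it carries [th1]
    into [th2]. *)
Lemma pbij_adjust (I J : finType) (th th' th1 : {set I * J}) :
    th \subset th' -> pbij th' -> pbij (th :|: th1) -> (#|th'| + #|th1| <= #|I|)%N ->
  exists2 s : {perm I}, {in dom th, forall i, s i = i} & pbij (th' :|: pact s 1%g th1).
Proof.
move=> /subsetP sth b' b1 le; have [|th2 [/subsetP s2 b2 r2]] := @pbij_extend_ran _ _ th' (ran th1) b'.
  apply: leq_trans le; rewrite -(card_ran b') cardsU.
  by apply: leq_trans (leq_subr _ _) _; rewrite leq_add2l leq_imset_card.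
pose sg := [set p : I * I | [exists j, ((p.1, j) \in th :|: th1) && ((p.2, j) \in th2)]].
have [|s sE] := @pbij_perm _ sg.
  apply/pbijP => i j i' j'; rewrite !inE => /existsP[c /andP[/= ic jc]] /existsP[d /andP[/= id jd]].
  by rewrite (pbijP _ b1 _ _ _ _ ic id) (pbijP _ b2 _ _ _ _ jc jd).
exists s => [i /domP[j ij]|].
  by apply: sE; rewrite inE; apply/existsP; exists j; rewrite inE ij /= s2 // sth.
apply: pbij_sub b2; apply/subsetP => p; rewrite inE => /orP[/s2 //|/pactP[i [j [ij ->]]]].
have /ranP[i' ij'] : j \in ran th2 by rewrite r2 inE (mem_ran ij) orbT.
rewrite perm1 (_ : s i = i') //; apply: sE; rewrite inE; apply/existsP; exists j.
by rewrite inE ij orbT.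
Qed.

(** * Transfer along partial bijections *)

Definition msupp (I : finType) (m : nat) (x : hf I) : Prop :=
  exists2 S : {set I}, (#|S| <= m)%N & supp S x.

Definition hsupp (I : finType) (m : nat) (x : hf I) : Prop :=
  forall y, in_tc y x -> msupp m y.

Section HereditarySupport.
Variable I : finType.
Implicit Types (x y : hf I) (m : nat).

Lemma hsupp_msupp m x : hsupp m x -> msupp m x.
Proof. by apply; apply: in_tc_refl. Qed.

Lemma hsupp_elts m x y : y \in elts x -> hsupp m x -> hsupp m y.
Proof. by move=> yx hx z zy; apply: hx; apply: in_tc_step zy. Qed.

Lemma hsuppI m x : msupp m x -> (forall y, y \in elts x -> hsupp m y) -> hsupp m x.
Proof.
by move=> mx H y yx; case: yx mx H => [//|z {}x zx yz] _ H; apply: (H z).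
Qed.

Lemma hsupp_leq m m' x : (m <= m')%N -> hsupp m x -> hsupp m' x.
Proof. by move=> le hx y /hx[S cS]; exists S => //; apply: leq_trans le. Qed.

Lemma hsupp_atom m a : (0 < m)%N -> hsupp m (atom a : hf I).
Proof.
move=> m0; apply: hsuppI; last by move=> y; rewrite elts_atom.
by exists [set a]; rewrite ?cards1 //; apply: supp_atom; rewrite inE.
Qed.

End HereditarySupport.

Section Transfer.
Variables (M : nat) (I J : finType).
Implicit Types (th : {set I * J}) (x : hf I).

(* The bound M on the size of [th'] is what leaves room for extending the partial
   bijections, so that [transfer] is injective on sets of small support even
   when the two atom sets have different sizes. *)
Definition step_ok th th' x : bool :=
  [&& pbij (th :|: th'), (#|th'| <= M)%N & supp (dom th') x].

(* An atom outside of the domain of [th] is sent to the junk value 0. *)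
Fixpoint tree_transfer th (t : hftree I) : hftree J :=
  match t with
  | Leaf i => if [pick j | (i, j) \in th] is Some j then Leaf j else Node [::]
  | Node ts => Node (flatten [seq [seq tree_transfer th' t' |
                  th' <- enum [pred th' | step_ok th th' (hf_class t')]] | t' <- ts])
  end.

(** An element is sent along every admissible [th'] at once, so no choice is made and the map is
    equivariant. Moreover [th'] replaces [th] instead of extending it: it is only compatible with
    [th] and has size at most [M], so the partial bijections do not grow with the rank of the
    set. *)
Definition transfer th x : hf J := hf_class (tree_transfer th (hf_repr x)).

Lemma tree_transfer_eqv th s t :
  hfeqv s t -> hfeqv (tree_transfer th s) (tree_transfer th t).
Proof.
elim/hftree_mem_ind: s t th => [a|ss IH] [b|ts] //= th.
  by move/eqP->; apply: hfeqv_refl.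
case/andP=> /allP st /allP ts'; apply/andP; split; apply/allP.
- move=> _ /flattenP[_ /mapP[s sss ->] /mapP[th' ok' ->]].
  case/hasP: (st _ sss) => t tts e.
  apply/hasP; exists (tree_transfer th' t); last exact: IH.
  apply/flattenP; eexists; first exact: map_f tts.
  by apply: map_f; rewrite -(elimT (hf_classP _ _) e).
- move=> _ /flattenP[_ /mapP[t tts ->] /mapP[th' ok' ->]].
  case/hasP: (ts' _ tts) => s sss e.
  apply/hasP; exists (tree_transfer th' s); last exact: IH.
  apply/flattenP; eexists; first exact: map_f sss.
  by apply: map_f; rewrite (elimT (hf_classP _ _) e).
Qed.

Lemma transfer_class th t : transfer th (hf_class t) = hf_class (tree_transfer th t).
Proof. by apply/hf_classP/tree_transfer_eqv/hf_classP; rewrite hf_reprK. Qed.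

Lemma transfer_atom th i j : pbij th -> (i, j) \in th -> transfer th (atom i) = atom j.
Proof.
move=> /pbijP H ij; rewrite /atom transfer_class /=; case: pickP => [j' ij'|/(_ j)].
  by have := H _ _ _ _ ij ij'; rewrite eqxx => /esym/eqP ->.
by rewrite ij.
Qed.

Lemma transfer_atom0 th i : i \notin dom th -> transfer th (atom i) = hf0 J.
Proof.
move=> id; rewrite /atom transfer_class /=; case: pickP => [j /mem_dom ij|_].
  by rewrite ij in id.
rewrite hf_class_Node; congr mkset.
by apply/fsetP => y; rewrite inE; apply/imfsetP => -[].
Qed.

Lemma elts_transfer th A y :
  y \in elts (transfer th (mkset A)) <->
  exists v th', [/\ v \in A, step_ok th th' v & y = transfer th' v].
Proof.
rewrite {1}/mkset transfer_class /= hf_class_Node eltsK; split.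
  case/imfsetP => /= _ /flattenP[_ /mapP[_ /mapP[v vA ->] ->] /mapP[th' ok' ->]] ->.
  exists v, th'; split=> //; rewrite mem_enum inE hf_reprK in ok' => //.
case=> v [th' [vA ok' ->]]; apply/imfsetP => /=; exists (tree_transfer th' (hf_repr v)) => //.
apply/flattenP; eexists; first by apply: map_f; apply: map_f vA.
by apply: map_f; rewrite mem_enum inE hf_reprK.
Qed.

Lemma transfer_mkset th A : transfer th (mkset A) = mkset (elts (transfer th (mkset A))).
Proof. by rewrite {1 2}/mkset transfer_class /= hf_class_Node eltsK. Qed.

Lemma transfer_eq_mkset th A B :
    (forall y, y \in B <-> exists v th', [/\ v \in A, step_ok th th' v & y = transfer th' v]) ->
  transfer th (mkset A) = mkset B.
Proof.
move=> H; rewrite transfer_mkset; congr mkset; apply/fsetP => y.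
by apply/idP/idP => [/elts_transfer/H|/H/elts_transfer].
Qed.

Lemma step_ok_pact s t th th' x :
  step_ok (pact s t th) (pact s t th') (hfmap s x) = step_ok th th' x.
Proof. by rewrite /step_ok -pactU pbij_pact card_pact dom_pact supp_mapE. Qed.

(** Since the definition involves no choice, permuting both sides merely reindexes the admissible
    [th']. *)
Lemma transfer_pact (s : {perm I}) (t : {perm J}) th x : pbij th ->
  transfer (pact s t th) (hfmap s x) = hfmap t (transfer th x).
Proof.
elim/hf_ind: x th => [i|A IH] th bth.
  rewrite hfmap_atom; have [/domP[j ij]|id] := boolP (i \in dom th).
    by rewrite (transfer_atom bth ij) hfmap_atom; apply: transfer_atom; rewrite ?pbij_pact ?mem_pact.
  rewrite !transfer_atom0 ?dom_pact ?mem_imset //; last exact: perm_inj.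
  rewrite /hf0 hfmap_mkset; congr mkset; apply/fsetP => y; rewrite inE.
  by apply/esym/imfsetP => -[].
rewrite [transfer th _]transfer_mkset !hfmap_mkset; apply: transfer_eq_mkset => y; split.
  case/imfsetP => /= _ /elts_transfer[v [th' [vA ok' ->]]] ->.
  exists (hfmap s v), (pact s t th'); rewrite step_ok_pact -IH //.
    by split=> //; apply/imfsetP; exists v.
  by case/and3P: ok' => /pbijUr.
case=> _ [th' [/imfsetP[/= v vA ->] ok' ->]]; rewrite -[th'](pactKV s t) in ok' *.
rewrite step_ok_pact in ok'; rewrite IH //; last by case/and3P: ok' => /pbijUr.
apply/imfsetP; eexists; last by []; apply/elts_transfer.
by exists v, (pact s^-1 t^-1 th').
Qed.

(** A permutation of [J] fixing the range pointwise leaves [th] unchanged; [transfer_pact] with the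
    identity on [I] then shows that it fixes the image. *)
Lemma transfer_supp th x : pbij th -> supp (ran th) (transfer th x).
Proof.
move=> bth; apply/suppP => a b ar br; rewrite -(transfer_pact 1%g) // hfmap1 pact_fix //.
  by move=> i _; rewrite perm1.
by move=> j jr; rewrite tpermD //; [apply: contraNneq ar|apply: contraNneq br] => ->.
Qed.

(** Whatever is compatible with [th'] is compatible with [th]. Conversely, [pbij_adjust] moves a
    [th1] compatible with [th] by a permutation [s] that fixes [dom th], hence fixes [x]: the
    element [v] becomes another element [hfmap s v] of [x], with the same image. *)
Lemma transfer_sub th th' x : (1 < M)%N -> th \subset th' -> pbij th' -> supp (dom th) x ->
  (#|th'| + M <= #|I|)%N -> transfer th x = transfer th' x.
Proof.
move=> M1 sth b' sx le; case: (hfP x) sx => [[i ->]|[A ->]] sx.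
  have /domP[j ij] : i \in dom th.
    apply: supp_atom_in sx; apply: leq_trans le; rewrite -addn2; apply: leq_add => //.
    exact: leq_trans (card_dom_le _) (subset_leq_card sth).
  rewrite (transfer_atom (pbij_sub sth b') ij).
  by rewrite (transfer_atom b' (subsetP sth _ ij)).
rewrite [RHS]transfer_mkset; apply: transfer_eq_mkset => y; split; last first.
  case=> v [th1 [vA /and3P[b1 c1 s1] ->]].
  have [|s sfix bs] := pbij_adjust sth b' b1.
    by apply: leq_trans le; rewrite leq_add2l.
  apply/elts_transfer; exists (hfmap s v), (pact s 1%g th1); split.
  - have := mem_elts_hfmap s (mkset A) v; rewrite (supp_perm sx) //= !eltsK => ->.
    exact: vA.
  - by rewrite /step_ok bs card_pact c1 dom_pact supp_mapE.
  - by rewrite transfer_pact ?hfmap1 //; apply: pbijUr b1.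
case/elts_transfer => v [th1 [vA /and3P[b1 c1 s1] ->]].
exists v, th1; split=> //; rewrite /step_ok c1 s1 !andbT.
by apply: pbij_sub b1; apply: setSU.
Qed.

End Transfer.

(* [room M I J n] : partial bijections of size n between I and J can be extended
   a few more times by M pairs. *)
Definition room (M : nat) (I J : finType) (n : nat) : bool :=
  [&& 1 < M, 5 * M <= #|I|, 5 * M <= #|J|, n + 4 * M <= #|I| & n + 4 * M <= #|J|]%N.

Lemma room_leq M I J n n' : (n <= n')%N -> room M I J n' -> room M I J n.
Proof. by rewrite /room; lia. Qed.

(** This is the purpose of the [5 * M] conditions in [room]: passing to an element replaces the
    partial bijection by one of size up to [M], which may exceed the size of the old one. *)
Lemma room_step M I J n n' : (n' <= M)%N -> room M I J n -> room M I J n'.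
Proof. by rewrite /room; lia. Qed.

Lemma room_cod M I J n : room M I J n -> (n <= #|J|)%N.
Proof. by case/and5P => _ _ _ _; apply: leq_trans; apply: leq_addr. Qed.

Lemma roomC M I J n : room M I J n = room M J I n.
Proof. by rewrite /room; lia. Qed.

(** * Invertibility of the transfer and back-and-forth moves *)

Section TransferInverse.
Variable M : nat.
Implicit Types I J : finType.

Lemma transfer_eq I J (th1 th2 : {set I * J}) x :
    (1 < M)%N -> pbij (th1 :|: th2) -> supp (dom th1) x -> supp (dom th2) x ->
    (#|th1| + #|th2| + M <= #|I|)%N ->
  transfer M th1 x = transfer M th2 x.
Proof.
move=> M1 b s1 s2 le.
have le' : (#|th1 :|: th2| + M <= #|I|)%N.
  by apply: leq_trans le; rewrite leq_add2r cardsU leq_subr.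
rewrite (transfer_sub M1 (subsetUl th1 th2) b s1 le').
by rewrite (transfer_sub M1 (subsetUr th1 th2) b s2 le').
Qed.

(** The difficulty is that an element of the double transfer comes from some [v] along [th1] and
    then along a [th2] related to the inverse of [th1] only through [th]. A permutation [s] fixing
    [dom th], hence [x], makes the inverse of [th2] compatible with [th1]; after this correction the
    second transfer agrees with that along the inverse of [th1], and the induction hypothesis
    returns [v]. *)
Lemma transferK I J (th : {set I * J}) x :
    room M I J #|th| -> pbij th -> supp (dom th) x -> hsupp M x ->
  transfer M (pinv th) (transfer M th x) = x.
Proof.
elim/hf_ind: x th => [i|A IH] th r b sx hx.
  have /domP[j ij] : i \in dom th.
    apply: supp_atom_in sx; have := card_dom_le th; move: r; rewrite /room; lia.
  by rewrite (transfer_atom _ b ij) (@transfer_atom _ _ _ _ _ i) ?pbij_pinv ?mem_pinv.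
rewrite [transfer M th _]transfer_mkset; apply: transfer_eq_mkset => y; split=> [yA|].
  have [|S cS sS] := hsupp_msupp (@hsupp_elts _ _ _ y _ hx); first by rewrite eltsK.
  have [|th1 [b1 d1 c1]] := pbij_cover_dom (S := S) b; first by move: r; rewrite /room; lia.
  have hy : hsupp M y by apply: hsupp_elts hx; rewrite eltsK.
  exists (transfer M th1 y), (pinv th1); split.
  - by apply/elts_transfer; exists y, th1; split=> //; rewrite /step_ok b1 c1 cS d1.
  - rewrite /step_ok -pinvU pbij_pinv b1 card_pinv c1 cS dom_pinv transfer_supp //.
    exact: pbijUr b1.
  - by rewrite IH ?d1 ?c1 //; [apply: room_step r | apply: pbijUr b1].
case=> _ [th2 [/elts_transfer[v [th1 [vA /and3P[b1 c1 s1] ->]]] /and3P[b2 c2 s2] ->]].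
have hv : hsupp M v by apply: hsupp_elts hx; rewrite eltsK.
have bt2 : pbij (th :|: pinv th2) by rewrite -pbij_pinv pinvU pinvK.
have [|s sfix bs] := pbij_adjust (subsetUl th th1) b1 bt2.
  by rewrite card_pinv; have := cardsU th th1; move: r; rewrite /room; lia.
suff e : hfmap s (transfer M th2 (transfer M th1 v)) = v.
  by rewrite -[A]eltsK -(mem_elts_hfmap s) (supp_perm sx) // e eltsK.
rewrite -[LHS](transfer_pact M 1%g) ?hfmap1; last exact: pbijUr b2.
have -> : pact 1%g s th2 = pinv (pact s 1%g (pinv th2)) by rewrite pinv_pact pinvK.
rewrite -[RHS](IH v vA th1) //; last 2 first.
- exact: room_step r.
- exact: pbijUr b1.
apply: transfer_eq.
- by case/andP: r.
- by rewrite -pinvU pbij_pinv setUC; apply: pbij_sub bs; apply: setSU; apply: subsetUr.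
- rewrite pinv_pact pinvK dom_pact (eq_imset (g := id)) ?imset_id // => j.
  by rewrite perm1.
- by rewrite dom_pinv transfer_supp //; apply: pbijUr b1.
- by rewrite !card_pinv card_pact card_pinv; move: r; rewrite /room; lia.
Qed.

Lemma transfer_inj I J (th : {set I * J}) x y :
    room M I J #|th| -> pbij th -> supp (dom th) x -> hsupp M x ->
    supp (dom th) y -> hsupp M y ->
  transfer M th x = transfer M th y -> x = y.
Proof.
by move=> r b sx hx sy hy e; rewrite -(transferK r b sx hx) e transferK.
Qed.

(** The image can be computed along a partial bijection whose domain is just a small support of [x],
    and the range of that one supports it. *)
Lemma transfer_msupp m I J (th : {set I * J}) x :
    (m <= M)%N -> room M I J #|th| -> pbij th -> supp (dom th) x -> msupp m x ->
  msupp m (transfer M th x).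
Proof.
move=> mM r b sx [S cS sS].
have [|th1 [b1 d1 c1]] := pbij_cover_dom (S := S) b; first by move: r; rewrite /room; lia.
have b1' := pbijUr b1; exists (ran th1); first by rewrite card_ran ?c1.
rewrite (_ : transfer M th x = transfer M th1 x) ?transfer_supp //.
by apply: transfer_eq; rewrite ?d1 //; move: r; rewrite /room; lia.
Qed.

Lemma transfer_hsupp m I J (th : {set I * J}) x :
    (m <= M)%N -> room M I J #|th| -> pbij th -> supp (dom th) x -> hsupp m x ->
  hsupp m (transfer M th x).
Proof.
move=> mM; elim/hf_ind: x th => [i|A IH] th r b sx hx; apply: hsuppI.
- exact: transfer_msupp (hsupp_msupp hx).
- have /domP[j ij] : i \in dom th.
    by apply: supp_atom_in sx; have := card_dom_le th; move: r; rewrite /room; lia.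
  by move=> y; rewrite (transfer_atom _ b ij) elts_atom.
- exact: transfer_msupp (hsupp_msupp hx).
- move=> _ /elts_transfer[v [th1 [vA /and3P[b1 c1 s1] ->]]]; apply: IH => //.
  + exact: room_step r.
  + exact: pbijUr b1.
  + by apply: hsupp_elts hx; rewrite eltsK.
Qed.

Lemma transfer_surj m I J (th : {set I * J}) y :
    (m <= M)%N -> room M I J #|th| -> pbij th -> supp (ran th) y -> hsupp m y ->
  exists x, [/\ hsupp m x, supp (dom th) x & transfer M th x = y].
Proof.
move=> mM r b sy hy; exists (transfer M (pinv th) y); split.
- by apply: transfer_hsupp => //; rewrite ?card_pinv 1?roomC ?pbij_pinv ?dom_pinv.
- by rewrite -ran_pinv transfer_supp ?pbij_pinv.
- rewrite -{1}[th]pinvK transferK ?card_pinv 1?roomC ?pbij_pinv ?dom_pinv //.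
  exact: hsupp_leq hy.
Qed.

(** The forth move: at most [m] new pairs make the domain support one more set. *)
Lemma extend_supp m I J (th : {set I * J}) x :
    (#|th| + m <= #|J|)%N -> pbij th -> hsupp m x ->
  exists th' : {set I * J}, [/\ th \subset th', pbij th', (#|th'| <= #|th| + m)%N & supp (dom th') x].
Proof.
move=> le b /hsupp_msupp[S cS sS]; have [|th1 [b1 d1 c1]] := pbij_cover_dom (S := S) b.
  by apply: leq_trans le; rewrite leq_add2l.
exists (th :|: th1); split=> //; first exact: subsetUl.
  by rewrite cardsU (leq_trans (leq_subr _ _)) // leq_add2l c1.
by rewrite domU d1; apply: supp_sub sS; apply: subsetUr.
Qed.

(** The back move, obtained from the forth move for the inverse partial bijection. *)
Lemma extend_surj m I J (th : {set I * J}) y :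
    (m <= M)%N -> room M I J (#|th| + M) -> pbij th -> hsupp m y ->
  exists (th' : {set I * J}) x, [/\ th \subset th', pbij th' & (#|th'| <= #|th| + m)%N] /\
    [/\ supp (dom th') x, hsupp m x & transfer M th' x = y].
Proof.
move=> mM r; rewrite -pbij_pinv -card_pinv => b hy.
have [|th' [s' b' c' s1]] := extend_supp (m := m) _ b hy.
  by rewrite card_pinv; move: r; rewrite /room; lia.
have [||||x [hx sx ex]] := @transfer_surj m _ _ (pinv th') y mM; rewrite ?ran_pinv ?pbij_pinv //.
  by apply: room_leq r; rewrite card_pinv (leq_trans c') // card_pinv leq_add2l.
exists (pinv th'), x; rewrite ?card_pinv ?pbij_pinv; split; split=> //.
- by rewrite -[th]pinvK pinv_sub.
- by rewrite card_pinv in c'.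
Qed.

(** Only the forward implication is proved by hand: [v] is sent along a [th1] over a small support,
    because [th] itself may be too large to be admissible. As [imp] holds for arbitrary atom sets,
    the converse is its instance for the inverse. *)
Lemma transfer_mem I J (th : {set I * J}) v x :
    room M I J #|th| -> pbij th -> supp (dom th) v -> hsupp M v ->
    supp (dom th) x -> hsupp M x ->
  (transfer M th v \in elts (transfer M th x)) = (v \in elts x).
Proof.
have imp I' J' (th' : {set I' * J'}) v' x' :
    room M I' J' #|th'| -> pbij th' -> supp (dom th') v' -> hsupp M v' ->
    supp (dom th') x' ->
    v' \in elts x' -> transfer M th' v' \in elts (transfer M th' x').
  move=> r b sv hv sx; case: (hfP x') sx => [[i ->]|[A ->]] sx; first by rewrite elts_atom.
  rewrite eltsK => vA; have [S cS sS] := hsupp_msupp hv.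
  have [|th1 [b1 d1 c1]] := pbij_cover_dom (S := S) b.
    by move: r; rewrite /room; lia.
  apply/elts_transfer; exists v', th1; split=> //.
    by rewrite /step_ok b1 d1 c1 cS.
  by apply: transfer_eq; rewrite ?d1 //; move: r; rewrite /room; lia.
move=> r b sv hv sx hx; apply/idP/idP; last exact: imp.
move=> H; rewrite -(transferK r b sv hv) -(transferK r b sx hx).
apply: imp H; rewrite ?card_pinv 1?roomC ?pbij_pinv ?dom_pinv ?transfer_supp //.
exact: transfer_hsupp.
Qed.

End TransferInverse.

(** * Supports in small families *)

Lemma ffact_ge n m : ((n - m) ^ m <= n ^_ m)%N.
Proof.
elim: m => // m IH; rewrite ffactnSr expnSr leq_mul //; last by lia.
by apply: leq_trans IH; case: m => // m; rewrite leq_exp2r //; lia.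
Qed.

Lemma bin_gt_monomial K d n :
  (2 * d.+1 <= n -> K * (2 ^ d.+1 * d.+1`!) < n -> K * n ^ d < 'C(n, d.+1))%N.
Proof.
move=> n2 nK; rewrite ltnNge; apply/negP => H.
have n0 : (0 < n)%N by lia.
suff : (n ^ d.+1 <= n ^ d * (K * (2 ^ d.+1 * d.+1`!)))%N.
  by rewrite expnSr leq_pmul2l ?expn_gt0 ?n0 // leqNgt nK.
have le2 : (n ^ d.+1 <= 2 ^ d.+1 * (n - d.+1) ^ d.+1)%N by rewrite -expnMn leq_exp2r //; lia.
apply: leq_trans le2 _; rewrite [(n ^ d * _)%N]mulnA [(n ^ d * _)%N]mulnC.
rewrite [(_ * (2 ^ _ * _))%N]mulnCA leq_mul2l; apply/orP; right.
apply: leq_trans (ffact_ge _ _) _; rewrite -bin_ffact.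
by rewrite leq_mul2r H orbT.
Qed.

Lemma leq_bin_half n m m' : (m <= m' -> 2 * m' <= n -> 'C(n, m) <= 'C(n, m'))%N.
Proof.
move=> le; elim: m' le => [|m' IH]; first by rewrite leqn0 => /eqP ->.
rewrite leq_eqVlt => /predU1P[-> //|]; rewrite ltnS => le n2.
apply: leq_trans (IH le _) _; first by lia.
rewrite -(@leq_pmul2l m'.+1) // mul_bin_left leq_mul2r; apply/orP; right; lia.
Qed.

Lemma bin_leq_exp2 r m : ('C(r, m) <= 2 ^ r)%N.
Proof.
rewrite -[in 'C(_, _)](card_ord r) -card_draws -[X in (2 ^ X)%N](card_ord r).
by rewrite -cardsT -card_powerset; apply: subset_leq_card; apply/subsetP => B _; rewrite inE subsetT.
Qed.

(** The exponent is kept positive because it becomes the support bound, which must be at least 1 to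
    admit atoms. *)
Lemma nat_poly_bound (p : {poly nat}) :
  exists d N, forall n, (N <= n -> p.[n]%R <= n ^ d.+1)%N.
Proof.
elim/poly_ind: p => [|p c [d [N H]]]; first by exists 0, 0; move=> n _; rewrite horner0.
exists d.+2, (N + c.+2)%N => n le.
have -> : (p * 'X + c%:P).[n]%R = (p.[n]%R * n + c)%N by rewrite hornerD hornerMX hornerC.
have n0 : (0 < n)%N by lia.
have n2 : (1 < n)%N by lia.
have le1 : (p.[n]%R * n <= n ^ d.+2)%N.
  by rewrite expnSr leq_mul2r H ?orbT // (leq_trans (leq_addr _ _) le).
have le2 : (c <= n ^ d.+2)%N.
  by apply: (@leq_trans n); [lia|rewrite -{1}[n]expn1 leq_pexp2l].
rewrite expnSr; apply: leq_trans (leq_add le1 le2) _.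
by rewrite addnn -muln2 leq_mul2l n2 orbT.
Qed.

Section BoundedFamilies.
Variable I : finType.
Implicit Types (x : hf I) (S : {set I}).

(* Each time, a transposition moving [x] maps some [v] in [x] out of [x]; since
   later transpositions avoid the small support of [v], products over
   different subsets of the transpositions yield different conjugates. *)
Lemma many_conjugates k r (A : {fset hf I}) S0 :
    (forall v, v \in A -> msupp k v) ->
    (forall S, S0 \subset S -> (#|S| <= #|S0| + r * k.+2)%N -> ~~ supp S (mkset A)) ->
  exists ss : seq {perm I},
    [/\ size ss = (2 ^ r)%N, {in ss, forall s : {perm I}, {in S0, forall a, s a = a}}
      & uniq [seq hfmap s (mkset A) | s : {perm I} <- ss]].
Proof.
move=> hA; elim: r S0 => [|r IH] S0 nS.
  by exists [:: 1%g]; split=> // s; rewrite inE => /eqP-> a _; rewrite perm1.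
have /suppP : ~~ supp S0 (mkset A) by apply: nS => //; apply: leq_addr.
pose x := mkset A; rewrite -/x.
have [/existsP[a /existsP[b /and3P[aS bS nab]]] _|no []] :=
    boolP [exists a, exists b, [&& a \notin S0, b \notin S0 & hfmap (tperm a b) x != x]]; last first.
  move=> a b aS bS; apply: contraNeq no => nab; apply/existsP; exists a; apply/existsP; exists b.
  by rewrite aS bS.
have [v vA nv] : exists2 v, v \in A & hfmap (tperm a b) v \notin A.
  have [/allP all_in|/allPn[v vA nv]] := boolP (all (fun v => hfmap (tperm a b) v \in A) A); last by exists v.
  case/eqP: nab; rewrite /x hfmap_mkset; congr mkset; apply/fsetP => w.
  apply/imfsetP/idP => /= [[v vA ->]|wA]; first exact: all_in.
  by exists (hfmap (tperm a b) w); rewrite ?hfmap_tpermK //; apply: all_in.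
have [T cT sT] := hA v vA.
(* The later permutations will fix [a], [b] and the support [T] of [v]; this freezes at most [k.+2]
   further atoms per round, whence the allowance [r * k.+2]. *)
pose S1 := S0 :|: ([set a; b] :|: T).
have cS1 : (#|S1| <= #|S0| + k.+2)%N.
  have := cardsU S0 ([set a; b] :|: T); have := cardsU [set a; b] T; have := cards2 a b.
  by rewrite -/S1; case: (a != b) => /=; lia.
have [|ss [sz fixS1 us]] := IH S1.
  move=> S sS cS; apply: nS; first exact: subset_trans (subsetUl _ _) sS.
  by apply: leq_trans cS _; rewrite mulSn; lia.
have fixS0 s : s \in ss -> {in S0, forall c, s c = c}.
  by move=> sss c cS; apply: fixS1 => //; rewrite inE cS.
exists (ss ++ [seq (s * tperm a b)%g | s <- ss]); split.
- by rewrite size_cat size_map sz expnS mul2n addnn.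
- move=> s; rewrite mem_cat => /orP[/fixS0 //|/mapP[s' /fixS0 s'f ->]] c cS.
  rewrite permM s'f // tpermD //; first by apply: contraNneq aS => ->.
  by apply: contraNneq bS => ->.
set im := [seq hfmap s x | s : {perm I} <- ss] in us *.
have -> : [seq hfmap s x | s : {perm I} <- ss ++ [seq (s * tperm a b)%g | s <- ss]] =
          im ++ [seq hfmap (tperm a b) y | y <- im].
  by rewrite map_cat -!map_comp; congr cat; apply: eq_map => s /=; rewrite hfmapM.
rewrite cat_uniq us map_inj_uniq ?us ?andbT /=; last exact: hfmap_inj.
apply/hasPn => _ /mapP[_ /mapP[s' s'ss ->] ->]; apply/mapP => -[s sss e].
(* The two halves are disjoint. As [s'] fixes [v], the set [hfmap s' x] contains [v], so by [e] its
   image under (a b), which is [hfmap s x], contains the image of [v]; [s] fixes this image as well,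
   so it would lie in [x]. *)
case/negP: nv; have : hfmap (tperm a b) v \in elts (hfmap s x).
  rewrite -e mem_elts_hfmap -{1}[v](supp_perm (s := s') sT).
    by rewrite mem_elts_hfmap eltsK.
  by move=> c cT'; apply: fixS1 => //; rewrite !inE cT' !orbT.
rewrite -{1}[hfmap _ v](supp_perm (s := s) (supp_map (tperm a b) sT)).
  by rewrite mem_elts_hfmap eltsK.
move=> _ /imsetP[c cT' ->]; apply: fixS1 => //.
by case: tpermP => [_|_|_ _]; rewrite !inE ?eqxx ?cT' ?orbT.
Qed.

Lemma perm_onto_set (S S' : {set I}) : #|S| = #|S'| -> exists s : {perm I}, s @: S = S'.
Proof.
move=> e; pose th := [set (enum_val i, enum_val (cast_ord e i)) | i in 'I_#|S|].
have bth : pbij th.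
  apply/pbijP => i j i' j' /imsetP[a _ [-> ->]] /imsetP[b _ [-> ->]].
  by rewrite !(inj_eq enum_val_inj) (inj_eq (@cast_ord_inj _ _ e)).
have [s sE] := pbij_perm bth; exists s; apply/eqP.
rewrite eqEcard card_imset ?e ?leqnn ?andbT; last exact: perm_inj.
apply/subsetP => _ /imsetP[a aS ->].
rewrite (sE _ (enum_val (cast_ord e (enum_rank_in aS a)))) ?enum_valP //.
by apply/imsetP; exists (enum_rank_in aS a); rewrite ?enum_rankK_in.
Qed.

(** Each set of size [#|S|] supports some conjugate of [x]. If two different ones gave the same
    conjugate, their intersection would support it, contradicting minimality; [2 * #|S| < #|I|]
    makes their union proper, as [supp_capl] requires. *)
Lemma min_supp_conjugates x S (X : {fset hf I}) :
    supp S x -> (forall S', supp S' x -> #|S| <= #|S'|)%N -> (2 * #|S| < #|I|)%N ->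
    (forall s : {perm I}, hfmap s x \in X) ->
  ('C(#|I|, #|S|) <= #|` X|)%N.
Proof.
move=> sS minS lt sX.
pose g (S' : {set I}) : {perm I} := odflt 1%g [pick s : {perm I} | s @: S == S'].
have gE S' : #|S'| = #|S| -> g S' @: S = S'.
  move=> /esym/perm_onto_set[s es]; rewrite /g; case: pickP => [t /eqP //|/(_ s)].
  by rewrite es eqxx.
rewrite -card_draws cardE -(size_map (fun S' => hfmap (g S') x)).
apply: uniq_leq_size; last by move=> _ /mapP[S' _ ->].
rewrite map_inj_in_uniq ?enum_uniq // => S1 S2.
rewrite !mem_enum !inE => /eqP c1 /eqP c2 e; apply/eqP.
have s1 : supp S1 (hfmap (g S1) x) by rewrite -{1}(gE S1 c1) supp_map.
have s2 : supp S2 (hfmap (g S1) x) by rewrite e -{1}(gE S2 c2) supp_map.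
have cI := cardsUI S1 S2.
have nT : S1 :|: S2 != setT.
  by apply: contraTneq lt => eT; rewrite -leqNgt -cardsT -eT; lia.
have := supp_capl nT s1 s2; rewrite -{1}[S1 :&: S2](imset_id) => sI.
have /minS : supp ((g S1)^-1%g @: (S1 :&: S2)) x.
  by rewrite -[x](hfmapK (g S1)) supp_mapE -{1}[_ :&: _]imset_id.
rewrite card_imset; last exact: perm_inj.
move=> le; rewrite eqEcard c1 c2 leqnn andbT; apply/setIidPl/eqP.
by rewrite eqEcard subsetIl c1.
Qed.

End BoundedFamilies.

(* [P] is an isomorphism-closed transitive family, like the active elements of
   a state.  Step 1: by [many_conjugates] there is a support of size
   less than a quarter of the universe.  Step 2: a smallest such support has at
   least binomially many conjugates. *)
Lemma bounded_family_msupp (p : {poly nat}) :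
  exists c N, forall (I : finType) (P : hf I -> Prop) (X : {fset hf I}),
    (N <= #|I|)%N -> (#|` X| <= p.[#|I|]%R)%N -> (forall x, P x -> x \in X) ->
    (forall (s : {perm I}) x, P x -> P (hfmap s x)) ->
    (forall x y, P x -> y \in elts x -> P y) ->
  forall x, P x -> msupp c.+1 x.
Proof.
have [d [N0 pN]] := nat_poly_bound p.
(* With [r = n %/ e], the [r] rounds of [many_conjugates] freeze at most [r * D.+2] atoms, a quarter
   of [n]. [f] is the constant of [bin_gt_monomial], and [r0] is chosen so that for [r >= r0] one
   has [2 ^ r > (2 * e * r) ^ D], which is at least [n ^ D]. *)
pose D := d.+1; pose e := (4 * D.+2)%N; pose f := (2 ^ D.+1 * D.+1`!)%N.
pose r0 := (2 * D.+1 + (2 * e) ^ D * f).+1.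
exists d, (N0 + e * r0 + 2 * D.+1 + f).+1 => I P X leN leX PX Ps Pe x.
set n := #|I| in leN leX; have n1 : (e * r0 <= n)%N by lia.
pose r := (n %/ e)%N; have e0 : (0 < e)%N by rewrite /e; lia.
have ltn : (n < r.+1 * e)%N by apply: ltn_ceil.
have len : (r * e <= n)%N by apply: leq_trunc_div.
have ler : (r0 <= r)%N by rewrite leq_divRL // mulnC.
have pn : (p.[n]%R <= n ^ D)%N by apply: pN; lia.
have exp_big : (n ^ D < 2 ^ r)%N.
  apply: leq_trans (bin_leq_exp2 r D.+1).
  apply: leq_ltn_trans (bin_gt_monomial (K := (2 * e) ^ D) _ _); rewrite -/f.
  - rewrite -expnMn leq_exp2r //; rewrite /r0 in ler.
    have : (1 * e <= r * e)%N by rewrite leq_mul2r; apply/orP; right; lia.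
    by move: ltn; rewrite mulSn -mulnA [(e * r)%N]mulnC mul1n; lia.
  - by move: ler; rewrite /r0; lia.
  - by move: ler; rewrite /r0; lia.
have bin_big : (n ^ D < 'C(n, D.+1))%N.
  have := bin_gt_monomial (K := 1) (d := D) (n := n); rewrite !mul1n; apply; rewrite -/f; lia.
(* Membership induction, possible as the family is transitive: the elements already have supports of
   size at most [D], as [many_conjugates] demands. *)
elim/hf_ind: x => [a _|A IH PA].
  by exists [set a]; rewrite ?cards1 //; apply: supp_atom; rewrite inE.
have hA v : v \in A -> msupp D v by move=> vA; apply: IH => //; apply: Pe PA _; rewrite eltsK.
have PX' (s : {perm I}) : hfmap s (mkset A) \in X by apply/PX/Ps.
have [S0 cS0 sS0] : exists2 S : {set I}, (#|S| <= r * D.+2)%N & supp S (mkset A).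
  have [/existsP[S /andP[sS cS]]|no] := boolP [exists S : {set I}, supp S (mkset A) && (#|S| <= r * D.+2)%N].
    by exists S.
  have [|ss [sz _ us]] := many_conjugates (r := r) (S0 := set0) hA.
    move=> S _; rewrite cards0 => cS; apply: contra no => sS.
    by apply/existsP; exists S; rewrite sS.
  have : (size [seq hfmap s (mkset A) | s : {perm I} <- ss] <= #|` X|)%N.
    by apply: uniq_leq_size => // _ /mapP[s _ ->].
  by rewrite size_map sz; lia.
have [S sS minS] := arg_minnP (P := fun S : {set I} => supp S (mkset A)) (fun S : {set I} => #|S|) sS0.
have cS : (#|S| <= r * D.+2)%N := leq_trans (minS _ sS0) cS0.
have cS' : (2 * #|S| < n)%N by move: len; rewrite /e; lia.
exists S => //; rewrite leqNgt; apply/negP => lt.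
have le := leq_trans (min_supp_conjugates sS minS cS' PX') (leq_trans leX pn).
by have := leq_trans bin_big (leq_trans (leq_bin_half lt (ltnW cS')) le); rewrite ltnn.
Qed.

(** * Set operations *)

Section SetOperations.
Variable I : choiceType.
Implicit Types x y : hf I.

Lemma elts_hf0 : elts (hf0 I) = fset0.
Proof. exact: eltsK. Qed.

Lemma mem_hf_union x y : y \in elts (hf_union x) <-> exists2 z, z \in elts x & y \in elts z.
Proof.
rewrite eltsK; split=> [/bigfcupP[z]|[z zx yz]]; first by rewrite andbT => zx yz; exists z.
by apply/bigfcupP; exists z; rewrite ?zx.
Qed.

Lemma mem_hf_pair x y z : (z \in elts (hf_pair x y)) = (z == x) || (z == y).
Proof. by rewrite eltsK !inE. Qed.

Variant the_unique_spec x : hf I -> Prop :=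
  | TheUniqueElt y of elts x = [fset y] : the_unique_spec x y
  | TheUniqueNone of (forall y, elts x <> [fset y]) : the_unique_spec x (hf0 I).

Lemma the_uniqueP x : the_unique_spec x (hf_the_unique x).
Proof.
rewrite /hf_the_unique; case ex: (enum_fset (elts x)) => [|y [|z s]].
- by apply: TheUniqueNone => y e; have := fset11 y; rewrite -e -[_ \in _]/(_ \in enum_fset _) ex.
- apply: TheUniqueElt; apply/fsetP => z.
  by rewrite -[LHS]/(z \in enum_fset _) ex !inE.
- apply: TheUniqueNone => w e; have := cardfs1 w.
  by rewrite -e -[#|` _|]/(size (enum_fset _)) ex.
Qed.

Lemma the_unique1 x y : elts x = [fset y] -> hf_the_unique x = y.
Proof. by case: the_uniqueP => [z -> /fset1_inj //|H /H]. Qed.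

Lemma the_unique0 x : (forall y, elts x <> [fset y]) -> hf_the_unique x = hf0 I.
Proof. by case: the_uniqueP => // y e /(_ y). Qed.

Lemma hfbool_inj : injective (hfbool I).
Proof.
by move=> [] [] //= /mkset_inj /fsetP /(_ (hf0 I)); rewrite !inE eqxx.
Qed.

End SetOperations.

Lemma mem_hf_atoms (I : finType) (x : hf I) : x \in elts (hf_atoms I) <-> exists a, x = atom a.
Proof.
rewrite eltsK; split=> [/imfsetP[/= a _ ->]|[a ->]]; first by exists a.
by apply/imfsetP; exists a.
Qed.

Section Equivariance.
Variable I : finType.
Implicit Types (x y : hf I) (s : {perm I}).

Lemma hfmap_mkset_eq s A B : (forall x, (hfmap s x \in B) = (x \in A)) -> hfmap s (mkset A) = mkset B.
Proof.
move=> H; rewrite hfmap_mkset; congr mkset; apply/fsetP => y.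
apply/imfsetP/idP => /= [[x xA ->]|yB]; first by rewrite H.
by exists (hfmap s^-1%g y); rewrite ?hfmapKV // -H hfmapKV.
Qed.

Lemma hfmap_hf0 s : hfmap s (hf0 I) = hf0 I.
Proof. by apply: hfmap_mkset_eq => x; rewrite !inE. Qed.

Lemma hfmap_hfbool s b : hfmap s (hfbool I b) = hfbool I b.
Proof.
case: b; last exact: hfmap_hf0.
by apply: hfmap_mkset_eq => x; rewrite !inE -{1}(hfmap_hf0 s) (inj_eq (@hfmap_inj _ s)).
Qed.

Lemma hfmap_hf_atoms s : hfmap s (hf_atoms I) = hf_atoms I.
Proof.
apply: hfmap_mkset_eq => x; rewrite -[[fset _ | _ in _]]eltsK.
apply/idP/idP => /mem_hf_atoms[a e]; apply/mem_hf_atoms.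
  by exists (s^-1%g a); rewrite -hfmap_atom -e hfmapK.
by exists (s a); rewrite e hfmap_atom.
Qed.

Lemma hfmap_hf_union s x : hfmap s (hf_union x) = hf_union (hfmap s x).
Proof.
apply: hfmap_mkset_eq => y; rewrite -[\bigcup_(_ <- elts x) _]eltsK -[\bigcup_(_ <- elts _) _]eltsK.
apply/idP/idP => /mem_hf_union[z zx yz]; apply/mem_hf_union.
  by exists (hfmap s^-1%g z); rewrite -(mem_elts_hfmap s) hfmapKV.
by exists (hfmap s z); rewrite mem_elts_hfmap.
Qed.

Lemma hfmap_hf_pair s x y : hfmap s (hf_pair x y) = hf_pair (hfmap s x) (hfmap s y).
Proof. by apply: hfmap_mkset_eq => z; rewrite !inE !(inj_eq (@hfmap_inj _ s)). Qed.

Lemma hfmap_the_unique s x : hfmap s (hf_the_unique x) = hf_the_unique (hfmap s x).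
Proof.
case: (the_uniqueP x) => [y e|H].
  apply/esym/the_unique1; rewrite elts_hfmap e; apply/fsetP => z.
  by rewrite inE; apply/imfsetP/eqP => /= [[w]|->]; [rewrite inE => /eqP->|exists y; rewrite ?inE].
rewrite hfmap_hf0; apply/esym/the_unique0 => y e; case: (H (hfmap s^-1%g y)).
apply/fsetP => z; rewrite -(mem_elts_hfmap s) e !inE.
by rewrite -[in RHS](inj_eq (@hfmap_inj _ s)) hfmapKV.
Qed.

End Equivariance.

Section HereditarySupportOps.
Variable I : finType.
Implicit Types (x y : hf I) (m : nat).

Lemma hsupp_equivariant m (z : hf I) :
  (forall s : {perm I}, hfmap s z = z) -> msupp m z.
Proof. by move=> zs; exists set0; rewrite ?cards0 //; apply/suppP => a b _ _; apply: zs. Qed.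

Lemma hsupp_hf0 m : hsupp m (hf0 I).
Proof.
apply: hsuppI => [|y]; last by rewrite elts_hf0 inE.
exact/hsupp_equivariant/hfmap_hf0.
Qed.

Lemma hsupp_hfbool m b : hsupp m (hfbool I b).
Proof.
case: b; last exact: hsupp_hf0; apply: hsuppI => [|y].
  exact/hsupp_equivariant/(fun s => hfmap_hfbool s true).
by rewrite eltsK inE => /eqP ->; apply: hsupp_hf0.
Qed.

Lemma hsupp_hf_atoms m : (0 < m)%N -> hsupp m (hf_atoms I).
Proof.
move=> m0; apply: hsuppI => [|y /mem_hf_atoms[a ->]]; last exact: hsupp_atom.
exact/hsupp_equivariant/hfmap_hf_atoms.
Qed.

Lemma common_supp m (xs : seq (hf I)) : (forall x, x \in xs -> msupp m x) ->
  exists2 S : {set I}, (#|S| <= size xs * m)%N & forall x, x \in xs -> supp S x.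
Proof.
elim: xs => [|x xs IH] H; first by exists set0; rewrite ?cards0.
have [|S cS sS] := IH; first by move=> y yxs; apply: H; rewrite inE yxs orbT.
have [T cT sT] := H x (mem_head _ _); exists (T :|: S).
  by rewrite mulSn cardsU (leq_trans (leq_subr _ _)) ?leq_add.
move=> y; rewrite inE => /predU1P[->|/sS]; last exact/supp_sub/subsetUr.
exact: supp_sub (subsetUl _ _) sT.
Qed.

End HereditarySupportOps.

(** * Compatibility of the transfer with the set operations *)

Section TransferOperations.
Variables (M : nat) (I J : finType).
Implicit Types (th : {set I * J}) (x : hf I).

Lemma transfer_up th th' x :
    th \subset th' -> room M I J #|th'| -> pbij th' -> supp (dom th) x ->
  transfer M th' x = transfer M th x.
Proof.
by move=> sth r b sx; apply/esym/transfer_sub => //; move: r; rewrite /room; lia.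
Qed.

(** The definition provides a [th1] that is merely compatible with [th]. Taking the union yields an
    extension of [th], along which sets already supported by [dom th] keep their images. *)
Lemma elts_transfer_up th x y :
    room M I J (#|th| + M) -> pbij th -> supp (dom th) x -> y \in elts (transfer M th x) ->
  exists th' u, [/\ th \subset th', pbij th' & (#|th'| <= #|th| + M)%N] /\
    [/\ supp (dom th') u, u \in elts x & transfer M th' u = y].
Proof.
move=> r b; case: (hfP x) => [[i ->]|[A ->]] sx.
  have /domP[j ij] : i \in dom th.
    by apply: supp_atom_in sx; have := card_dom_le th; move: r; rewrite /room; lia.
  by rewrite (transfer_atom _ b ij) elts_atom.
case/elts_transfer => v [th1 [vA /and3P[b1 c1 s1] ->]].
have c' : (#|th :|: th1| <= #|th| + M)%N.
  by rewrite cardsU (leq_trans (leq_subr _ _)) // leq_add2l.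
exists (th :|: th1), v; split; split; rewrite ?eltsK ?subsetUl //.
  by rewrite domU; apply: supp_sub s1; apply: subsetUr.
by apply: transfer_up; rewrite ?subsetUr //; apply: room_leq r.
Qed.

(** An extensionality principle: every element of either side is the image of some [u] along an
    extension of [th], by [elts_transfer_up] on the left and by the back move on the right, so it
    suffices to compare memberships of such images. *)
Lemma transfer_mkset_ext th A B :
    room M I J (#|th| + M) -> pbij th -> supp (dom th) (mkset A) -> hsupp M (mkset A) ->
    (forall y, y \in B -> hsupp M y) ->
    (forall th' u, th \subset th' -> pbij th' -> (#|th'| <= #|th| + M)%N ->
       supp (dom th') u -> hsupp M u -> (transfer M th' u \in B) = (u \in A)) ->
  transfer M th (mkset A) = mkset B.
Proof.
move=> r b sA hA hB H; rewrite transfer_mkset; congr mkset; apply/fsetP => y.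
apply/idP/idP => [yA|yB].
  have [th' [u [[sth b' c'] [su uA <-]]]] := elts_transfer_up r b sA yA.
  by rewrite eltsK in uA; rewrite H //; apply: hsupp_elts hA; rewrite eltsK.
have [th' [u [[sth b' c'] [su hu e]]]] := extend_surj (leqnn M) r b (hB y yB).
rewrite -e -(transfer_up sth _ b' sA) ?transfer_mem ?eltsK -?(H th') ?e //.
- by apply: room_leq r.
- by apply: supp_sub sA; apply: dom_sub.
- by apply: room_leq r.
Qed.

Lemma transfer_hf0 th : room M I J (#|th| + M) -> pbij th -> transfer M th (hf0 I) = hf0 J.
Proof.
move=> r b; apply: transfer_mkset_ext => //; try exact: hsupp_hf0.
  by apply/suppP => *; apply: hfmap_hf0.
Qed.

Lemma supp_hfbool S b : supp S (hfbool I b).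
Proof. by apply/suppP => *; apply: hfmap_hfbool. Qed.

Lemma transfer_hfbool th b : room M I J (#|th| + M) -> pbij th ->
  transfer M th (hfbool I b) = hfbool J b.
Proof.
case: b => r b; last exact: transfer_hf0.
apply: transfer_mkset_ext => //.
- exact: supp_hfbool true.
- exact: hsupp_hfbool true.
- by move=> y; rewrite inE => /eqP ->; apply: hsupp_hf0.
move=> th' u sth b' c' su hu; rewrite !inE.
have r' : room M I J #|th'| by apply: room_leq r.
apply/eqP/eqP => [e|->].
  apply: (transfer_inj r' b' su hu (supp_hfbool _ false)); first exact: hsupp_hf0.
  rewrite e -(transfer_hf0 r b); apply/esym/transfer_up => //.
  exact: supp_hfbool false.
rewrite -(transfer_hf0 r b); apply/transfer_up => //.
exact: supp_hfbool false.
Qed.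

Lemma transfer_is_atom th x j :
    room M I J #|th| -> pbij th -> supp (dom th) x -> hsupp M x ->
  transfer M th x = atom j -> (exists i, x = atom i).
Proof.
move=> r b sx hx; case: (hfP x) => // -[A ->]; rewrite transfer_mkset => e.
by have := atom_neq_mkset j (elts (transfer M th (mkset A))); rewrite -e eqxx.
Qed.

Lemma transfer_atomE th i : room M I J #|th| -> pbij th -> supp (dom th) (atom i) ->
  exists2 j, (i, j) \in th & transfer M th (atom i) = atom j.
Proof.
move=> r b sx; have /domP[j ij] : i \in dom th.
  by apply: supp_atom_in sx; have := card_dom_le th; move: r; rewrite /room; lia.
by exists j => //; apply: transfer_atom.
Qed.

Lemma transfer_hf_atoms th : room M I J (#|th| + M) -> pbij th ->
  transfer M th (hf_atoms I) = hf_atoms J.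
Proof.
move=> r b; have M0 : (0 < M)%N by case/and5P: r => /ltnW.
apply: transfer_mkset_ext => //; first by apply/suppP => *; apply: hfmap_hf_atoms.
- exact: hsupp_hf_atoms.
- by move=> y; rewrite -[X in _ \in X]eltsK => /mem_hf_atoms[a ->]; apply: hsupp_atom.
move=> th' u sth b' c' su hu.
have r' : room M I J #|th'| by apply: room_leq r.
rewrite -[X in _ \in X]eltsK -[X in _ = (_ \in X)]eltsK.
apply/idP/idP => /mem_hf_atoms[a e]; apply/mem_hf_atoms.
  exact: transfer_is_atom e.
by rewrite e in su *; have [j _ ->] := transfer_atomE r' b' su; exists j.
Qed.

(** The reserve [2 * M] pays for two extensions: one to reach the tested element [u], one to reach
    the set [z] between [u] and [x]. *)
Lemma transfer_hf_union th x :
    room M I J (#|th| + 2 * M) -> pbij th -> supp (dom th) x -> hsupp M x ->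
    hsupp M (hf_union x) -> hsupp M (hf_union (transfer M th x)) ->
  transfer M th (hf_union x) = hf_union (transfer M th x).
Proof.
move=> r b sx hx hU hU'.
have r1 : room M I J (#|th| + M) by apply: room_leq r; lia.
apply: transfer_mkset_ext => //.
- by apply/suppP => a c aS cS; rewrite hfmap_hf_union (suppP _ _ sx).
- by move=> y yU; apply: hsupp_elts hU'; rewrite eltsK.
move=> th' u sth b' c' su hu.
rewrite -[X in _ \in X]eltsK -[X in _ = (_ \in X)]eltsK.
have r' : room M I J (#|th'| + M) by apply: room_leq r; lia.
have r'0 : room M I J #|th'| by apply: room_leq r'; lia.
have sx' : supp (dom th') x by apply: supp_sub sx; apply: dom_sub.
rewrite -(transfer_up sth r'0 b' sx).
apply/idP/idP => /mem_hf_union[z zx uz]; apply/mem_hf_union.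
  have [th2 [v [[s2 b2 c2] [sv vx e]]]] := elts_transfer_up r' b' sx' zx.
  exists v => //; have hv := hsupp_elts vx hx.
  have r2 : room M I J #|th2| by apply: room_leq r'.
  rewrite -(transfer_mem r2 b2) // ?e ?(transfer_up s2) //.
  by apply: supp_sub su; apply: dom_sub.
have hz := hsupp_elts zx hx.
have [th2 [s2 b2 c2 sz]] := extend_supp (room_cod r') b' hz.
have r2 : room M I J #|th2| by apply: room_leq r'.
have su2 : supp (dom th2) u by apply: supp_sub su; apply: dom_sub.
have sx2 : supp (dom th2) x by apply: supp_sub sx'; apply: dom_sub.
exists (transfer M th2 z).
  by rewrite -(transfer_up s2 r2 b2 sx') transfer_mem.
by rewrite -(transfer_up s2 r2 b2 su) transfer_mem.
Qed.

Lemma transfer_hf_pair th x y :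
    room M I J (#|th| + M) -> pbij th -> supp (dom th) x -> hsupp M x ->
    supp (dom th) y -> hsupp M y -> hsupp M (hf_pair x y) ->
  transfer M th (hf_pair x y) = hf_pair (transfer M th x) (transfer M th y).
Proof.
move=> r b sx hx sy hy hp; have r0 : room M I J #|th| by apply: room_leq r; lia.
apply: transfer_mkset_ext => //.
- by apply/suppP => a c aS cS; rewrite hfmap_hf_pair (suppP _ _ sx) ?(suppP _ _ sy).
- by move=> z; rewrite !inE => /orP[]/eqP->; apply: transfer_hsupp.
move=> th' u sth b' c' su hu; have r' : room M I J #|th'| by apply: room_leq r.
rewrite !inE -(transfer_up sth r' b' sx) -(transfer_up sth r' b' sy).
have inj w : supp (dom th) w -> hsupp M w -> (transfer M th' u == transfer M th' w) = (u == w).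
  move=> sw hw; apply/eqP/eqP => [|-> //]; apply: transfer_inj => //.
  by apply: supp_sub sw; apply: dom_sub.
by rewrite !inj.
Qed.

(** If the image of [x] is a singleton, its element is the image of some [u] in [x]; any [v] in [x]
    acquires the same image along a further extension, and injectivity gives [v = u]. *)
Lemma transfer_the_unique th x :
    room M I J (#|th| + 2 * M) -> pbij th -> supp (dom th) x -> hsupp M x ->
  transfer M th (hf_the_unique x) = hf_the_unique (transfer M th x).
Proof.
move=> r b sx hx; have r1 : room M I J (#|th| + M) by apply: room_leq r; lia.
have r0 : room M I J #|th| by apply: room_leq r1; lia.
have st : supp (dom th) (hf_the_unique x).
  by apply/suppP => a c aS cS; rewrite hfmap_the_unique (suppP _ _ sx).
case: (the_uniqueP x) st => [y e|H] sy.
  have hy : hsupp M y by apply: hsupp_elts hx; rewrite e inE.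
  apply/esym/the_unique1/fsetP => z; rewrite inE; apply/idP/eqP => [zT|->].
    have [th' [u [[sth b' c'] [su ux <-]]]] := elts_transfer_up r1 b sx zT.
    move: ux; rewrite e inE => /eqP ->; apply: transfer_up => //.
    exact: room_leq r1.
  by rewrite transfer_mem ?e ?inE.
rewrite transfer_hf0 //; apply/esym/the_unique0 => w e.
have [|th' [u [[sth b' c'] [su ux eu]]]] := @elts_transfer_up th x w r1 b sx.
  by rewrite e inE.
case: (H u); apply/fsetP => v; rewrite inE; apply/idP/eqP => [vx|-> //].
have hv := hsupp_elts vx hx; have hu := hsupp_elts ux hx.
have r' : room M I J (#|th'| + M).
  by apply: room_leq r; rewrite mul2n -addnn addnA leq_add2r.
have [th2 [s2 b2 c2 sv]] := extend_supp (room_cod r') b' hv.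
have r2 : room M I J #|th2| by apply: room_leq r'.
have su2 : supp (dom th2) u by apply: supp_sub su; apply: dom_sub.
have s02 := subset_trans sth s2.
have sx2 : supp (dom th2) x by apply: supp_sub sx; apply: dom_sub.
apply: (transfer_inj r2 b2 sv hv su2 hu).
rewrite (transfer_up s2 r2 b2 su) eu; apply/fset1P; rewrite -e -(transfer_up s02 r2 b2 sx).
by rewrite transfer_mem.
Qed.

End TransferOperations.

(** * Evaluation *)

Definition complete_graph (I : finType) : structure digraph_vocab I :=
  fun (R : digraph_vocab) (a : 2.-tuple I) => tnth a ord0 != tnth a ord_max.

Lemma input_completeP (I : finType) (R : digraph_vocab) (xs : seq (hf I)) :
  reflect (exists i j, i != j /\ xs = [:: atom i; atom j])
          (input_holds (@complete_graph I) R xs).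
Proof.
apply: (iffP existsP) => [[a /andP[ne /eqP ->]]|[i [j [ne ->]]]].
  case: a ne => -[|i [|j [|? ?]]] //= sz ne; exists i, j; split=> //.
by exists [tuple i; j]; rewrite /complete_graph ne /= eqxx.
Qed.

Lemma input_hfmap (I : finType) (s : {perm I}) (R : digraph_vocab) (xs : seq (hf I)) :
  input_holds (@complete_graph I) R (map (hfmap s) xs) =
  input_holds (@complete_graph I) R xs.
Proof.
apply/input_completeP/input_completeP => -[i [j [ne E]]]; last first.
  by exists (s i), (s j); rewrite E /= !hfmap_atom (inj_eq perm_inj).
exists (s^-1%g i), (s^-1%g j); rewrite (inj_eq perm_inj); split=> //.
by apply: (inj_map (@hfmap_inj _ s)); rewrite E /= !hfmap_atom !permKV.
Qed.

Scheme term_mind := Induction for term Sort Prop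
  with bterm_mind := Induction for bterm Sort Prop.
Combined Scheme term_bterm_ind from term_mind, bterm_mind.

Lemma mem_compr (T U : choiceType) (f : T -> U) (E : {fset T}) (g : pred T) x :
  reflect (exists y, [/\ y \in E, g y & x = f y]) (x \in [fset f y | y in [fset y in E | g y]]).
Proof.
apply: (iffP idP) => [/imfsetP[/= y]|[y [yE gy ->]]].
  by rewrite !inE => /andP[yE gy] ->; exists y.
by apply/imfsetP; exists y => //=; rewrite !inE yE.
Qed.

Section Evaluation.
Variables (F P : vocab).
Local Notation V := digraph_vocab.
Local Notation term := (term V F P).
Local Notation bterm := (bterm V F P).
Local Notation rule := (rule V F P).

Definition map_location (I J : choiceType) (f : hf I -> hf J) (l : (F + P) * seq (hf I)) :
  (F + P) * seq (hf J) := (l.1, map f l.2).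

Definition map_update (I J : choiceType) (f : hf I -> hf J) (u : ((F + P) * seq (hf I)) * hf I) :
  ((F + P) * seq (hf J)) * hf J := (map_location f u.1, f u.2).

Lemma map_cons_tuple (I J : choiceType) (f : hf I -> hf J) k x (e : k.-tuple (hf I)) :
  map_tuple f (cons_tuple x e) = cons_tuple (f x) (map_tuple f e).
Proof. exact: val_inj. Qed.

Section EvalEquivariance.
Variable I : finType.
Implicit Types (st : state F P I) (s : {perm I}).

Definition equivariant st : Prop :=
  forall s l, st (map_location (hfmap s) l) = hfmap s (st l).

Lemma eval_equivariant st s : equivariant st -> forall k,
  (forall (t : term k) (e : k.-tuple (hf I)),
     eval (@complete_graph I) st (map_tuple (hfmap s) e) t =
     hfmap s (eval (@complete_graph I) st e t)) /\
  (forall (g : bterm k) (e : k.-tuple (hf I)),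
     beval (@complete_graph I) st (map_tuple (hfmap s) e) g =
     beval (@complete_graph I) st e g).
Proof.
move=> eq_st; apply: (@term_bterm_ind V F P
  (fun k t => forall e : k.-tuple (hf I),
     eval (@complete_graph I) st (map_tuple (hfmap s) e) t =
     hfmap s (eval (@complete_graph I) st e t))
  (fun k g => forall e : k.-tuple (hf I),
     beval (@complete_graph I) st (map_tuple (hfmap s) e) g =
     beval (@complete_graph I) st e g)) => k /=.
- by move=> i e; rewrite tnth_map.
- by move=> e; rewrite hfmap_hf0.
- by move=> e; rewrite hfmap_hf_atoms.
- by move=> t IH e; rewrite IH hfmap_hf_union.
- by move=> t IH e; rewrite IH hfmap_the_unique.
- by move=> t IHt u IHu e; rewrite IHt IHu hfmap_hf_pair.
- move=> f ts IH e; rewrite -eq_st /map_location /=; congr (st (_, _)).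
  by rewrite -map_comp; apply: eq_map => i; apply: IH.
- move=> t IHt r IHr g IHg e; apply/esym/hfmap_mkset_eq => x; rewrite IHr.
  apply/mem_compr/mem_compr => -[y [yr gy ex]].
    exists (hfmap s^-1%g y); rewrite -(mem_elts_hfmap s) hfmapKV yr; split=> //.
      by rewrite -IHg map_cons_tuple hfmapKV.
    by apply: (@hfmap_inj _ s); rewrite -IHt map_cons_tuple hfmapKV.
  exists (hfmap s y); rewrite mem_elts_hfmap yr -map_cons_tuple IHg; split=> //.
  by rewrite IHt ex.
- by move=> g IHg e; rewrite IHg hfmap_hfbool.
- by [].
- by [].
- by move=> g IH e; rewrite IH.
- by move=> g IHg h IHh e; rewrite IHg IHh.
- by move=> g IHg h IHh e; rewrite IHg IHh.
- by move=> t IHt u IHu e; rewrite IHt IHu (inj_eq (@hfmap_inj _ s)).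
- by move=> t IHt u IHu e; rewrite IHt IHu mem_elts_hfmap.
- move=> R ts IH e; rewrite -[RHS](input_hfmap s) -map_comp; congr input_holds.
  by apply: eq_map => i; apply: IH.
- move=> p ts IH e; rewrite -[RHS](inj_eq (@hfmap_inj _ s)) (hfmap_hfbool s true).
  rewrite -eq_st /map_location /= -map_comp; congr (st (_, _) == _).
  by apply: eq_map => i; apply: IH.
Qed.

Lemma updates_equivariant st s : equivariant st ->
  forall k (R : rule k) (e : k.-tuple (hf I)) u,
  (map_update (hfmap s) u \in updates (@complete_graph I) st (map_tuple (hfmap s) e) R) =
  (u \in updates (@complete_graph I) st e R).
Proof.
move=> eq_st; have Ht k t e := (eval_equivariant s eq_st k).1 t e.
have Hg k g e := (eval_equivariant s eq_st k).2 g e.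
have inj_u : injective (map_update (hfmap s)).
  by move=> [[f xs] v] [[f' xs'] v'] [-> /(inj_map (@hfmap_inj _ s)) -> /hfmap_inj ->].
move=> k R; elim: R => {k} /= [k|k f ts t|k p ts g|k g R1 IH1 R2 IH2|k r R IH] e u.
- by rewrite !inE.
- rewrite !inE -[RHS](inj_eq inj_u) /map_update /map_location /= Ht -map_comp.
  by congr (_ == (_, _, _)); apply: eq_map => i; apply: Ht.
- rewrite !inE -[RHS](inj_eq inj_u) /map_update /map_location /= Hg hfmap_hfbool -map_comp.
  by congr (_ == (_, _, _)); apply: eq_map => i; apply: Ht.
- by rewrite Hg; case: ifP.
- rewrite Ht; apply/bigfcupP/bigfcupP => -[x]; rewrite andbT => xr ux.
    exists (hfmap s^-1%g x); first by rewrite andbT -(mem_elts_hfmap s) hfmapKV.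
    by rewrite -IH map_cons_tuple hfmapKV.
  by exists (hfmap s x); rewrite ?andbT ?mem_elts_hfmap // -map_cons_tuple IH.
Qed.

End EvalEquivariance.

End Evaluation.

(** * Support bounds for the values of terms and rules *)

Section Bounds.
Variables (F P : vocab).
Local Notation V := digraph_vocab.
Local Notation term := (term V F P).
Local Notation bterm := (bterm V F P).
Local Notation rule := (rule V F P).

(* A support size for the transitive closure of the value of a term, given one
   for the environment and the state: the value itself is supported by the union
   of the supports of its k arguments. *)
Fixpoint tbound k (t : term k) (m : nat) : nat :=
  match t with
  | Var _ | EmptySet => m
  | Atoms => maxn 1 m
  | Union t => maxn (k * m) (tbound t m)
  | TheUnique t => tbound t m
  | Pair t u => maxn (k * m) (maxn (tbound t m) (tbound u m))
  | DynFun f ts => maxn m (\max_(i < arity f) tbound (ts i) m)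
  | Compr t r g =>
      let m' := maxn m (tbound r m) in
      maxn (k * m) (maxn m' (maxn (tbound t m') (bbound g m')))
  | OfBool g => bbound g m
  end
with bbound k (g : bterm k) (m : nat) : nat :=
  match g with
  | TrueB | FalseB => m
  | NotB g => bbound g m
  | AndB g h | OrB g h => maxn (bbound g m) (bbound h m)
  | Equal t u | Mem t u => maxn (tbound t m) (tbound u m)
  | Input R ts => \max_(i < arity R) tbound (ts i) m
  | DynRel p ts => \max_(i < arity p) tbound (ts i) m
  end.

Fixpoint rbound k (R : rule k) (m : nat) : nat :=
  match R with
  | Skip => m
  | UpdateFun f ts t => maxn (tbound t m) (\max_(i < arity f) tbound (ts i) m)
  | UpdateRel p ts g => maxn (bbound g m) (\max_(i < arity p) tbound (ts i) m)
  | Cond g R1 R2 => maxn (bbound g m) (maxn (rbound R1 m) (rbound R2 m))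
  | Forall r R => let m' := maxn m (tbound r m) in maxn m' (rbound R m')
  end.

Fixpoint tdepth k (t : term k) : nat :=
  match t with
  | Var _ | EmptySet | Atoms => 0
  | Union t | TheUnique t => tdepth t
  | Pair t u => maxn (tdepth t) (tdepth u)
  | DynFun f ts => \max_(i < arity f) tdepth (ts i)
  | Compr t r g => (maxn (tdepth r) (maxn (tdepth t) (bdepth g))).+1
  | OfBool g => bdepth g
  end
with bdepth k (g : bterm k) : nat :=
  match g with
  | TrueB | FalseB => 0
  | NotB g => bdepth g
  | AndB g h | OrB g h => maxn (bdepth g) (bdepth h)
  | Equal t u | Mem t u => maxn (tdepth t) (tdepth u)
  | Input R ts => \max_(i < arity R) tdepth (ts i)
  | DynRel p ts => \max_(i < arity p) tdepth (ts i)
  end.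

Fixpoint rdepth k (R : rule k) : nat :=
  match R with
  | Skip => 0
  | UpdateFun f ts t => maxn (tdepth t) (\max_(i < arity f) tdepth (ts i))
  | UpdateRel p ts g => maxn (bdepth g) (\max_(i < arity p) tdepth (ts i))
  | Cond g R1 R2 => maxn (bdepth g) (maxn (rdepth R1) (rdepth R2))
  | Forall r R => (maxn (tdepth r) (rdepth R)).+1
  end.

Definition location_arity (f : F + P) : nat :=
  match f with inl f => arity f | inr p => arity p end.

Section HsuppEval.
Variables (I : finType) (st : state F P I) (c : nat).
Hypothesis eq_st : equivariant st.
Hypothesis st_bounded : forall l, hsupp c (st l).
Local Notation eval := (eval (@complete_graph I) st).
Local Notation updates := (updates (@complete_graph I) st).

Lemma eval_supp S k (t : term k) (e : k.-tuple (hf I)) :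
  (forall x, x \in e -> supp S x) -> supp S (eval e t).
Proof.
move=> Se; apply/suppP => a b aS bS; rewrite -(eval_equivariant _ eq_st k).1.
congr Defs.eval; apply: val_inj => /=; apply: map_id_in => x /Se /suppP; exact.
Qed.

Lemma eval_msupp m k (t : term k) (e : k.-tuple (hf I)) :
  (forall x, x \in e -> hsupp m x) -> msupp (k * m) (eval e t).
Proof.
move=> he; have [|S cS sS] := @common_supp I m e; first by move=> x /he/hsupp_msupp.
by exists S; [rewrite size_tuple in cS | apply: eval_supp].
Qed.

(** A newly formed set gets its own support from the environment through [eval_msupp], and its
    members theirs from the induction hypothesis. Boolean terms need no claim, since truth values
    are invariant under all permutations. *)
Lemma eval_hsupp k (t : term k) m (e : k.-tuple (hf I)) :
  (c <= m)%N -> (forall x, x \in e -> hsupp m x) -> hsupp (tbound t m) (eval e t).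
Proof.
move: k t m e; apply: (@term_mind V F P (fun k t => forall m (e : k.-tuple (hf I)),
  (c <= m)%N -> (forall x, x \in e -> hsupp m x) -> hsupp (tbound t m) (eval e t))
  (fun _ _ => True)) => // k.
- by move=> i m e cm he; apply: he; apply: mem_tnth.
- by move=> m e cm he; apply: hsupp_hf0.
- by move=> m e cm he; apply: hsupp_hf_atoms; rewrite leq_max.
- move=> t IH m e cm he; apply: hsuppI => [|y /= /mem_hf_union[z zt yz]].
    have [S cS sS] := eval_msupp (Union t) he; exists S => //.
    by apply: leq_trans cS _; apply: leq_maxl.
  apply: hsupp_elts yz _; apply: hsupp_elts zt _.
  by apply: hsupp_leq (IH _ _ cm he); apply: leq_maxr.
- move=> t IH m e cm he /=; case: the_uniqueP => [y e1|_]; last exact: hsupp_hf0.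
  by apply: hsupp_elts (IH _ _ cm he); rewrite e1 inE.
- move=> t IHt u IHu m e cm he; apply: hsuppI => [|y].
    have [S cS sS] := eval_msupp (Pair t u) he; exists S => //.
    by apply: leq_trans cS _; apply: leq_maxl.
  rewrite /= mem_hf_pair => /orP[]/eqP->.
    by apply: hsupp_leq (IHt _ _ cm he); rewrite /= !leq_max leqnn !orbT.
  by apply: hsupp_leq (IHu _ _ cm he); rewrite /= !leq_max leqnn !orbT.
- move=> f ts IH m e cm he /=.
  apply: (@hsupp_leq _ c); first by apply: leq_trans cm _; apply: leq_maxl.
  exact: st_bounded.
- move=> t IHt r IHr g _ m e cm he; apply: hsuppI => [|y].
    have [S cS sS] := eval_msupp (Compr t r g) he; exists S => //.
    by apply: leq_trans cS _; apply: leq_maxl.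
  rewrite /= eltsK => /mem_compr[z [zr _ ->]].
  apply: (@hsupp_leq _ (tbound t (maxn m (tbound r m)))).
    by rewrite !leq_max leqnn !orbT.
  apply: IHt; first by rewrite leq_max cm.
  move=> x; rewrite inE => /predU1P[->|/he]; last by apply: hsupp_leq; apply: leq_maxl.
  by apply: hsupp_leq (leq_maxr _ _) _; apply: hsupp_elts zr _; apply: IHr.
- by move=> g _ m e cm he; apply: hsupp_hfbool.
Qed.

Lemma updates_hsupp k (R : rule k) m (e : k.-tuple (hf I)) u :
    (c <= m)%N -> (forall x, x \in e -> hsupp m x) -> u \in updates e R ->
  [/\ size u.1.2 = location_arity u.1.1,
      forall x, x \in u.1.2 -> hsupp (rbound R m) x & hsupp (rbound R m) u.2].
Proof.
elim: R m e => {k} [k|k f ts t|k p ts g|k g R1 IH1 R2 IH2|k r R IH] m e cm he /=.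
- by rewrite inE.
- rewrite inE => /eqP -> /=; rewrite size_map size_enum_ord; split=> // [x /mapP[i _ ->]|].
    apply: (@hsupp_leq _ (tbound (ts i) m)); last exact: eval_hsupp.
    by rewrite leq_max (leq_bigmax (F := fun i => tbound (ts i) m)) orbT.
  by apply: (@hsupp_leq _ (tbound t m)); [apply: leq_maxl|apply: eval_hsupp].
- rewrite inE => /eqP -> /=; rewrite size_map size_enum_ord; split=> // [x /mapP[i _ ->]|].
    apply: (@hsupp_leq _ (tbound (ts i) m)); last exact: eval_hsupp.
    by rewrite leq_max (leq_bigmax (F := fun i => tbound (ts i) m)) orbT.
  exact: hsupp_hfbool.
- have le1 : (rbound R1 m <= maxn (bbound g m) (maxn (rbound R1 m) (rbound R2 m)))%N.
    by rewrite !leq_max leqnn !orbT.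
  have le2 : (rbound R2 m <= maxn (bbound g m) (maxn (rbound R1 m) (rbound R2 m)))%N.
    by rewrite !leq_max leqnn !orbT.
  case: ifP => _ => [/(IH1 _ _ cm he)|/(IH2 _ _ cm he)] [-> hx hv]; split=> //.
  + by move=> x /hx; apply: hsupp_leq.
  + exact: hsupp_leq hv.
  + by move=> x /hx; apply: hsupp_leq.
  + exact: hsupp_leq hv.
- case/bigfcupP => x; rewrite andbT => xr ux.
  have [|y|-> hx hv] := IH (maxn m (tbound r m)) _ _ _ ux.
  + by rewrite leq_max cm.
  + rewrite inE => /predU1P[->|/he]; last by apply: hsupp_leq; apply: leq_maxl.
    by apply: hsupp_leq (leq_maxr _ _) _; apply: hsupp_elts xr _; apply: eval_hsupp.
  split=> //; last by apply: hsupp_leq hv; apply: leq_maxr.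
  by move=> y /hx; apply: hsupp_leq; apply: leq_maxr.
Qed.

End HsuppEval.

End Bounds.

(** * Simulation of terms and rules across two atom sets *)

Section Simulation.
Variables (F P : vocab) (M : nat) (I J : finType).
Local Notation V := digraph_vocab.
Local Notation term := (term V F P).
Local Notation bterm := (bterm V F P).
Local Notation rule := (rule V F P).
Implicit Types th : {set I * J}.

(** Agreement is required along every partial bijection that leaves a reserve of [B] atoms, so that
    it can be used in whatever environment a location is read. *)
Definition state_sim (B : nat) (sI : state F P I) (sJ : state F P J) : Prop :=
  forall th (l : (F + P) * seq (hf I)), room M I J (#|th| + B) -> pbij th ->
    size l.2 = location_arity l.1 ->
    (forall x, x \in l.2 -> hsupp M x) -> (forall x, x \in l.2 -> supp (dom th) x) ->
  sJ (map_location (transfer M th) l) = transfer M th (sI l).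

Lemma transfer_map_inj th (xs ys : seq (hf I)) :
    room M I J #|th| -> pbij th ->
    (forall x, x \in xs -> hsupp M x) -> (forall x, x \in xs -> supp (dom th) x) ->
    (forall x, x \in ys -> hsupp M x) -> (forall x, x \in ys -> supp (dom th) x) ->
  map (transfer M th) xs = map (transfer M th) ys -> xs = ys.
Proof.
move=> r b; elim: xs ys => [|x xs IH] [|y ys] //= hx sx hy sy [exy exys].
congr cons; last first.
  apply: IH => // z zs; [exact: hx _ (mem_behead _)|exact: sx _ (mem_behead _)| |].
    exact: hy _ (mem_behead _).
  exact: sy _ (mem_behead _).
by apply: (transfer_inj r b) exy; [apply: sx|apply: hx|apply: sy|apply: hy]; apply: mem_head.
Qed.

Lemma transfer_map_up th th' (xs : seq (hf I)) :
    th \subset th' -> room M I J #|th'| -> pbij th' ->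
    (forall x, x \in xs -> supp (dom th) x) ->
  map (transfer M th') xs = map (transfer M th) xs.
Proof. by move=> sth r b sx; apply/eq_in_map => x /sx; apply: transfer_up. Qed.

(** Adjacency in a complete graph is distinctness of atoms, which every partial bijection preserves
    and reflects; this makes complete graphs of different sizes locally alike. *)
Lemma input_transfer th (R : digraph_vocab) (xs : seq (hf I)) :
    room M I J #|th| -> pbij th ->
    (forall x, x \in xs -> hsupp M x) -> (forall x, x \in xs -> supp (dom th) x) ->
  input_holds (@complete_graph J) R (map (transfer M th) xs) =
  input_holds (@complete_graph I) R xs.
Proof.
move=> r b hx sx; apply/input_completeP/input_completeP => -[i [j [ne E]]].
  case: xs E hx sx => [|x [|y [|? ?]]] //= [ex ey] hx sx.
  have xin : x \in [:: x; y] by rewrite inE eqxx.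
  have yin : y \in [:: x; y] by rewrite !inE eqxx orbT.
  have [i' ei] := transfer_is_atom r b (sx x xin) (hx x xin) ex.
  have [j' ej] := transfer_is_atom r b (sx y yin) (hx y yin) ey.
  by exists i', j'; rewrite ei ej; split=> //; apply: contraNneq ne => e; rewrite -(inj_eq (@atom_inj _)) -ex -ey ei ej e.
have [i' ii ei] := transfer_atomE r b (sx (atom i) (eq_rect_r (fun s => _ \in s) (mem_head _ _) E)).
have [|j' jj ej] := @transfer_atomE _ _ _ th j r b; first by apply: sx; rewrite E !inE eqxx orbT.
by exists i', j'; rewrite E /= ei ej -(pbijP _ b _ _ _ _ ii jj).
Qed.

Lemma state_supp (I' : finType) (st : state F P I') S (l : (F + P) * seq (hf I')) :
  equivariant st -> (forall x, x \in l.2 -> supp S x) -> supp S (st l).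
Proof.
move=> eq_st Sl; apply/suppP => a b aS bS; rewrite -eq_st; congr (st _).
case: l Sl => f xs Sl; rewrite /map_location /=; congr (_, _).
by apply: map_id_in => x /Sl /suppP; apply.
Qed.

Variables (sI : state F P I) (sJ : state F P J) (c B : nat).
Hypotheses (eqI : equivariant sI) (eqJ : equivariant sJ).
Hypotheses (bI : forall l, hsupp c (sI l)) (bJ : forall l, hsupp c (sJ l)).
Hypotheses (B_ge : (3 * M <= B)%N) (sim : state_sim B sI sJ).
Local Notation evalI := (eval (@complete_graph I) sI).
Local Notation evalJ := (eval (@complete_graph J) sJ).
Local Notation bevalI := (beval (@complete_graph I) sI).
Local Notation bevalJ := (beval (@complete_graph J) sJ).
Local Notation T := (transfer M).

(* Each nested binder may enlarge [th] by 2 * M pairs; D counts the binders still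
   to be entered. *)
Definition env_ok m D th k (e : k.-tuple (hf I)) : Prop :=
  [/\ (c <= m <= M)%N, pbij th, room M I J (#|th| + (2 * M * D + B)),
      forall x, x \in e -> hsupp m x & forall x, x \in e -> supp (dom th) x].

Lemma env_ok_leq m D D' th k (e : k.-tuple (hf I)) :
  (D' <= D)%N -> env_ok m D th e -> env_ok m D' th e.
Proof.
move=> le [cm b r he se]; split=> //; apply: room_leq r.
by rewrite leq_add2l leq_add2r leq_mul2l le orbT.
Qed.

Lemma env_ok_room m D th k (e : k.-tuple (hf I)) n :
  (n <= 3)%N -> env_ok m D th e -> room M I J (#|th| + n * M).
Proof.
move=> n3 [_ _ r _ _]; apply: room_leq r; rewrite leq_add2l.
apply: leq_trans (leq_addl _ _); apply: leq_trans B_ge.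
by rewrite leq_mul2r n3 orbT.
Qed.

Lemma env_ok_hsupp m D th k (e : k.-tuple (hf I)) (t : term k) :
  env_ok m D th e -> (tbound t m <= M)%N -> hsupp M (evalI e t).
Proof. by move=> [/andP[cm _] _ _ he _] le; apply: hsupp_leq le _; apply: (eval_hsupp (c := c)). Qed.

Lemma env_ok_supp m D th k (e : k.-tuple (hf I)) (t : term k) :
  env_ok m D th e -> supp (dom th) (evalI e t).
Proof. by move=> [_ _ _ _ se]; apply: eval_supp. Qed.

Lemma env_ok_hsuppJ m D th k (e : k.-tuple (hf I)) (t : term k) :
  env_ok m D th e -> (tbound t m <= M)%N -> hsupp M (evalJ (map_tuple (T th) e) t).
Proof.
move=> ok le; have [/andP[cm mM] b r he se] := ok; have := env_ok_room (n := 0) isT ok.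
rewrite mul0n addn0 => r0.
apply: hsupp_leq le _; apply: (eval_hsupp (c := c)) => // x /mapP[y ye ->].
by apply: transfer_hsupp => //; [apply: se|apply: he].
Qed.

(** One unit of depth pays for [2 * M] pairs: in a comprehension [th] is first extended for the
    element whose membership is tested, then for the value of the bound variable. *)
Lemma env_ok_cons m m' D th th' k (e : k.-tuple (hf I)) x :
    env_ok m D.+1 th e -> th \subset th' -> pbij th' -> (#|th'| <= #|th| + 2 * M)%N ->
    (m <= m' <= M)%N -> hsupp m' x -> supp (dom th') x ->
  env_ok m' D th' (cons_tuple x e) /\
  map_tuple (T th') (cons_tuple x e) = cons_tuple (T th' x) (map_tuple (T th) e).
Proof.
move=> ok sth b' c' /andP[mm' m'M] hx sx; have [/andP[cm mM] b r he se] := ok.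
have r' : room M I J (#|th'| + (2 * M * D + B)).
  by apply: room_leq r; rewrite mulnS -(addnA (2 * M)) [leqRHS]addnA leq_add2r.
split; last first.
  rewrite map_cons_tuple; congr cons_tuple; apply: val_inj => /=.
  by apply: transfer_map_up => //; apply: room_leq r'; apply: leq_addr.
split=> //; first by rewrite m'M (leq_trans cm).
- by move=> y; rewrite inE => /predU1P[->|/he] //; apply: hsupp_leq.
- move=> y; rewrite inE => /predU1P[->|/se] //; apply: supp_sub; exact: dom_sub.
Qed.

Lemma eval_beval_sim k :
  (forall (t : term k) m th (e : k.-tuple (hf I)),
     env_ok m (tdepth t) th e -> (tbound t m <= M)%N ->
     evalJ (map_tuple (T th) e) t = T th (evalI e t)) /\
  (forall (g : bterm k) m th (e : k.-tuple (hf I)),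
     env_ok m (bdepth g) th e -> (bbound g m <= M)%N ->
     bevalJ (map_tuple (T th) e) g = bevalI e g).
Proof.
apply: (@term_bterm_ind V F P
  (fun k t => forall m th (e : k.-tuple (hf I)),
     env_ok m (tdepth t) th e -> (tbound t m <= M)%N ->
     evalJ (map_tuple (T th) e) t = T th (evalI e t))
  (fun k g => forall m th (e : k.-tuple (hf I)),
     env_ok m (bdepth g) th e -> (bbound g m <= M)%N ->
     bevalJ (map_tuple (T th) e) g = bevalI e g)) => {}k.
- by move=> i m th e ok le /=; rewrite tnth_map.
- move=> m th e ok le /=; have [_ b _ _ _] := ok; rewrite transfer_hf0 //.
  by have := env_ok_room (n := 1) isT ok; rewrite mul1n.
- move=> m th e ok le /=; have [_ b _ _ _] := ok; rewrite transfer_hf_atoms //.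
  by have := env_ok_room (n := 1) isT ok; rewrite mul1n.
- move=> t IH m th e ok le; have [_ b _ _ _] := ok.
  have le1 : (tbound t m <= M)%N by apply: leq_trans le; apply: leq_maxr.
  have hJ := env_ok_hsuppJ (t := Union t) ok le.
  rewrite /= (IH m) // in hJ *; rewrite transfer_hf_union //.
  + exact: env_ok_room ok.
  + exact: env_ok_supp ok.
  + exact: env_ok_hsupp ok _.
  + exact: env_ok_hsupp (Union t) ok le.
- move=> t IH m th e ok le; have [_ b _ _ _] := ok.
  rewrite /= (IH m) // transfer_the_unique //.
  + exact: env_ok_room ok.
  + exact: env_ok_supp ok.
  + exact: env_ok_hsupp ok _.
- move=> t IHt u IHu m th e ok le; have [_ b _ _ _] := ok.
  have := le; rewrite /= !geq_max => /and3P[_ le1 le2].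
  have ok1 := env_ok_leq (leq_maxl _ _) ok; have ok2 := env_ok_leq (leq_maxr _ _) ok.
  rewrite (IHt m) // (IHu m) // transfer_hf_pair //.
  + by have := env_ok_room (n := 1) isT ok; rewrite mul1n.
  + exact: env_ok_supp ok.
  + exact: env_ok_hsupp ok _.
  + exact: env_ok_supp ok.
  + exact: env_ok_hsupp ok _.
  + exact: (env_ok_hsupp (t := Pair t u) ok le).
- move=> f ts IH m th e ok le; have [_ b r _ _] := ok.
  have := le; rewrite /= geq_max => /andP[_ /bigmax_leqP le1].
  have ok1 i : env_ok m (tdepth (ts i)) th e.
    by apply: env_ok_leq ok => /=; apply: (leq_bigmax (F := fun i => tdepth (ts i))).
  rewrite -sim //=.
  + rewrite /map_location /= -map_comp; congr (sJ (_, _)).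
    by apply: eq_map => i; apply: (IH i m); rewrite ?le1.
  + by apply: room_leq r; rewrite leq_add2l leq_addl.
  + by rewrite size_map size_enum_ord.
  + by move=> _ /mapP[i _ ->]; apply: env_ok_hsupp (ok1 i) _; apply: le1.
  + by move=> _ /mapP[i _ ->]; apply: env_ok_supp (ok1 i).
- move=> t IHt r IHr g IHg m th e ok le; have [/andP[cm mM] b r0 he se] := ok.
  set m' := maxn m (tbound r m).
  have := le; rewrite /= -/m' !geq_max => /and4P[_ /andP[_ ler] let_ leg].
  have m'M : (m' <= M)%N by rewrite geq_max mM.
  have okr : env_ok m (tdepth r) th e.
    by apply: env_ok_leq ok => /=; apply: leqW; apply: leq_maxl.
  have ok' : env_ok m (maxn (tdepth t) (bdepth g)).+1 th e.
    by apply: env_ok_leq ok => /=; rewrite ltnS; apply: leq_maxr.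
  have r1 : room M I J (#|th| + M) by have := env_ok_room (n := 1) isT ok; rewrite mul1n.
  have r2 := env_ok_room (n := 2) isT ok.
  have sr : supp (dom th) (evalI e r) by apply: env_ok_supp okr.
  have hr : hsupp m' (evalI e r).
    by apply: hsupp_leq (leq_maxr _ _) _; apply: (eval_hsupp (c := c)).
  have er : evalJ (map_tuple (T th) e) r = T th (evalI e r) by apply: IHr okr ler.
  apply/esym/transfer_mkset_ext => //.
  + exact: (env_ok_supp (Compr t r g) ok).
  + exact: (env_ok_hsupp (t := Compr t r g) ok le).
  + by move=> y yB; apply: hsupp_elts (env_ok_hsuppJ (t := Compr t r g) ok le); rewrite /= eltsK.
  move=> th' u sth b' c' su hu.
  have key th2 y : th \subset th2 -> pbij th2 -> (#|th2| <= #|th| + 2 * M)%N ->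
      y \in elts (evalI e r) -> supp (dom th2) y ->
      bevalJ (cons_tuple (T th2 y) (map_tuple (T th) e)) g = bevalI (cons_tuple y e) g /\
      evalJ (cons_tuple (T th2 y) (map_tuple (T th) e)) t = T th2 (evalI (cons_tuple y e) t) /\
      supp (dom th2) (evalI (cons_tuple y e) t) /\ hsupp M (evalI (cons_tuple y e) t).
    move=> s2 b2 c2 yr sy.
    have [|ok2 <-] := env_ok_cons (m' := m') ok' s2 b2 c2 _ (hsupp_elts yr hr) sy.
      by rewrite leq_maxl m'M.
    have okt := env_ok_leq (leq_maxl _ _) ok2; have okg := env_ok_leq (leq_maxr _ _) ok2.
    split; first by apply: IHg okg leg.
    split; first by apply: IHt okt let_.
    by split; [apply: env_ok_supp okt | apply: env_ok_hsupp okt let_].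
  have r' : room M I J (#|th'| + M).
    by apply: room_leq r2; rewrite mul2n -addnn addnA leq_add2r.
  have c2' th2 : (#|th2 : {set I * J}| <= #|th'| + M)%N -> (#|th2| <= #|th| + 2 * M)%N.
    by move=> c2; rewrite (leq_trans c2) // mul2n -addnn addnA leq_add2r.
  have sr' : supp (dom th') (evalI e r) by apply: supp_sub sr; apply: dom_sub.
  have r0' : room M I J #|th'| by apply: room_leq r'; apply: leq_addr.
  have er' : evalJ (map_tuple (T th) e) r = T th' (evalI e r).
    by rewrite er; apply/esym/transfer_up.
  (* A witness over [J] is pulled back to some [y] over [I] along an extension [th2]; [u] and the
     value at [y] then have equal images along [th2], so they coincide. A witness over [I] is pushed
     forward by the forth move. *)
  apply/mem_compr/mem_compr => -[z [zr gz ez]].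
    rewrite er' in zr; have [th2 [y [[s2 b2 c2] [sy yr ezy]]]] := elts_transfer_up r' b' sr' zr.
    have [|eg [et [st ht]]] := key th2 y (subset_trans sth s2) b2 _ yr sy; first exact: c2'.
    have r22 : room M I J #|th2| by apply: room_leq r'.
    exists y; rewrite -eg ezy; split=> //.
    apply: (transfer_inj r22 b2) => //; first by apply: supp_sub su; apply: dom_sub.
    by rewrite -et ezy -ez; apply: transfer_up.
  have [th2 [s2 b2 c2 sy]] := extend_supp (room_cod r') b' (hsupp_leq m'M (hsupp_elts zr hr)).
  have [|eg [et [st ht]]] := key th2 z (subset_trans sth s2) b2 _ zr sy; first exact: c2'.
  have r22 : room M I J #|th2| by apply: room_leq r'.
  exists (T th2 z); rewrite eg et er' gz; split=> //.
    rewrite -(transfer_up s2 r22 b2 sr') transfer_mem //.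
    + exact: hsupp_leq m'M (hsupp_elts zr hr).
    + by apply: supp_sub sr'; apply: dom_sub.
    + exact: hsupp_leq m'M hr.
  by rewrite -ez; apply/esym/transfer_up.
- move=> g IH m th e ok le /=; have [_ b _ _ _] := ok; rewrite (IH m) // transfer_hfbool //.
  by have := env_ok_room (n := 1) isT ok; rewrite mul1n.
- by [].
- by [].
- by move=> g IH m th e ok le /=; rewrite (IH m).
- move=> g IHg h IHh m th e ok /=; rewrite geq_max => /andP[le1 le2].
  by rewrite (IHg m) ?(IHh m) //; apply: env_ok_leq ok; rewrite ?leq_maxl ?leq_maxr.
- move=> g IHg h IHh m th e ok /=; rewrite geq_max => /andP[le1 le2].
  by rewrite (IHg m) ?(IHh m) //; apply: env_ok_leq ok; rewrite ?leq_maxl ?leq_maxr.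
- move=> t IHt u IHu m th e ok /=; rewrite geq_max => /andP[le1 le2].
  have ok1 := env_ok_leq (leq_maxl _ _) ok; have ok2 := env_ok_leq (leq_maxr _ _) ok.
  rewrite (IHt m) // (IHu m) //; have [_ b _ _ _] := ok; apply/eqP/eqP => [|-> //].
  have := env_ok_room (n := 0) isT ok; rewrite addn0 => r.
  by apply: transfer_inj => //; [apply: env_ok_supp ok|apply: env_ok_hsupp ok1 _|
    apply: env_ok_supp ok|apply: env_ok_hsupp ok2 _].
- move=> t IHt u IHu m th e ok /=; rewrite geq_max => /andP[le1 le2].
  have ok1 := env_ok_leq (leq_maxl _ _) ok; have ok2 := env_ok_leq (leq_maxr _ _) ok.
  rewrite (IHt m) // (IHu m) //; have [_ b _ _ _] := ok.
  have := env_ok_room (n := 0) isT ok; rewrite addn0 => r.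
  by apply: transfer_mem => //; [apply: env_ok_supp ok|apply: env_ok_hsupp ok1 _|
    apply: env_ok_supp ok|apply: env_ok_hsupp ok2 _].
- move=> R ts IH m th e ok; rewrite [bbound _ _]/= => /bigmax_leqP le1; have [_ b _ _ _] := ok.
  have ok1 i : env_ok m (tdepth (ts i)) th e.
    by apply: env_ok_leq ok => /=; apply: (leq_bigmax (F := fun i => tdepth (ts i))).
  have := env_ok_room (n := 0) isT ok; rewrite addn0 => r /=.
  rewrite -(input_transfer _ r b).
  + rewrite -map_comp; congr input_holds.
    by apply: eq_map => i; apply: (IH i m) (ok1 i) _; apply: le1.
  + by move=> _ /mapP[i _ ->]; apply: env_ok_hsupp (ok1 i) _; apply: le1.
  + by move=> _ /mapP[i _ ->]; apply: env_ok_supp (ok1 i).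
- move=> p ts IH m th e ok; rewrite [bbound _ _]/= => /bigmax_leqP le1; have [/andP[cm mM] b rB _ _] := ok.
  have ok1 i : env_ok m (tdepth (ts i)) th e.
    by apply: env_ok_leq ok => /=; apply: (leq_bigmax (F := fun i => tdepth (ts i))).
  have := env_ok_room (n := 0) isT ok; rewrite addn0 => r /=.
  have r1 : room M I J (#|th| + M) by have := env_ok_room (n := 1) isT ok; rewrite mul1n.
  set l := (inr p, [seq evalI e (ts i) | i <- enum 'I_(arity p)]).
  have hl x : x \in l.2 -> hsupp M x.
    by move=> /mapP[i _ ->]; apply: env_ok_hsupp (ok1 i) _; apply: le1.
  have sl x : x \in l.2 -> supp (dom th) x.
    by move=> /mapP[i _ ->]; apply: env_ok_supp (ok1 i).
  have -> : (inr p, [seq evalJ (map_tuple (T th) e) (ts i) | i <- enum 'I_(arity p)]) =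
      map_location (T th) l.
    rewrite /map_location /= -map_comp; congr (_, _).
    by apply: eq_map => i; apply: (IH i m) (ok1 i) _; apply: le1.
  rewrite sim //.
  + rewrite -[hf1 J](transfer_hfbool true r1 b); apply/eqP/eqP => [|-> //].
    apply: (transfer_inj r b).
    * exact: state_supp.
    * exact: hsupp_leq (leq_trans cm mM) _.
    * exact: (supp_hfbool _ true).
    * exact: hsupp_hfbool true.
  + by apply: room_leq rB; rewrite leq_add2l leq_addl.
  + by rewrite size_map size_enum_ord.
Qed.

Lemma eval_sim k (t : term k) m th (e : k.-tuple (hf I)) :
  env_ok m (tdepth t) th e -> (tbound t m <= M)%N ->
  evalJ (map_tuple (T th) e) t = T th (evalI e t).
Proof. exact: (eval_beval_sim k).1. Qed.

Lemma beval_sim k (g : bterm k) m th (e : k.-tuple (hf I)) :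
  env_ok m (bdepth g) th e -> (bbound g m <= M)%N ->
  bevalJ (map_tuple (T th) e) g = bevalI e g.
Proof. exact: (eval_beval_sim k).2. Qed.

Lemma map_update_inj th (u v : ((F + P) * seq (hf I)) * hf I) :
    room M I J #|th| -> pbij th ->
    (forall x, x \in u.2 :: u.1.2 -> hsupp M x) ->
    (forall x, x \in u.2 :: u.1.2 -> supp (dom th) x) ->
    (forall x, x \in v.2 :: v.1.2 -> hsupp M x) ->
    (forall x, x \in v.2 :: v.1.2 -> supp (dom th) x) ->
  (map_update (T th) u == map_update (T th) v) = (u == v).
Proof.
case: u v => [[f xs] x] [[f' ys] y] r b hu su hv sv; apply/eqP/eqP => [|-> //].
case=> -> exs ex; have [-> ->] // : x :: xs = y :: ys.
by apply: (transfer_map_inj r b hu su hv sv) => /=; rewrite ex exs.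
Qed.

Lemma updates_sim k (R : rule k) m th (e : k.-tuple (hf I)) u :
    env_ok m (rdepth R) th e -> (rbound R m <= M)%N ->
    (forall x, x \in u.2 :: u.1.2 -> hsupp M x) ->
    (forall x, x \in u.2 :: u.1.2 -> supp (dom th) x) ->
  (map_update (T th) u \in updates (@complete_graph J) sJ (map_tuple (T th) e) R) =
  (u \in updates (@complete_graph I) sI e R).
Proof.
elim: R m th e => {k} [k|k f ts t|k p ts g|k g R1 IH1 R2 IH2|k r R IH] m th e ok.
- by rewrite !inE.
- rewrite [rbound _ _]/= geq_max => /andP[let_ /bigmax_leqP le1] hu su; rewrite /= !inE.
  have okt := env_ok_leq (leq_maxl _ _) ok; have okm := env_ok_leq (leq_maxr _ _) ok.
  have ok1 i : env_ok m (tdepth (ts i)) th e.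
    by apply: env_ok_leq okm; apply: (leq_bigmax (F := fun i => tdepth (ts i))).
  have [_ b _ _ _] := ok; have := env_ok_room (n := 0) isT ok; rewrite addn0 => r.
  rewrite -[RHS](map_update_inj r b) //=.
  + rewrite /map_update /map_location /= -map_comp (eval_sim okt let_).
    congr (_ == (_, _, _)); apply: eq_map => i /=.
    by apply: eval_sim (ok1 i) _; apply: le1.
  + move=> x; rewrite inE => /predU1P[->|/mapP[i _ ->]].
      exact: env_ok_hsupp okt let_.
    by apply: env_ok_hsupp (ok1 i) _; apply: le1.
  + move=> x; rewrite inE => /predU1P[->|/mapP[i _ ->]]; first exact: env_ok_supp okt.
    exact: env_ok_supp (ok1 i).
- rewrite [rbound _ _]/= geq_max => /andP[leg /bigmax_leqP le1] hu su; rewrite /= !inE.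
  have okg := env_ok_leq (leq_maxl _ _) ok; have okm := env_ok_leq (leq_maxr _ _) ok.
  have ok1 i : env_ok m (tdepth (ts i)) th e.
    by apply: env_ok_leq okm; apply: (leq_bigmax (F := fun i => tdepth (ts i))).
  have [_ b _ _ _] := ok; have := env_ok_room (n := 0) isT ok; rewrite addn0 => r.
  have r1 : room M I J (#|th| + M) by have := env_ok_room (n := 1) isT ok; rewrite mul1n.
  rewrite -[RHS](map_update_inj r b) //=.
  + rewrite /map_update /map_location /= -map_comp transfer_hfbool // (beval_sim okg leg).
    congr (_ == (_, _, _)); apply: eq_map => i /=.
    by apply: eval_sim (ok1 i) _; apply: le1.
  + move=> x; rewrite inE => /predU1P[->|/mapP[i _ ->]]; first exact: hsupp_hfbool.
    by apply: env_ok_hsupp (ok1 i) _; apply: le1.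
  + move=> x; rewrite inE => /predU1P[->|/mapP[i _ ->]]; first exact: supp_hfbool.
    exact: env_ok_supp (ok1 i).
- rewrite [rbound _ _]/= !geq_max => /and3P[leg le1 le2] hu su /=.
  have okg := env_ok_leq (leq_maxl _ _) ok; have okm := env_ok_leq (leq_maxr _ _) ok.
  rewrite (beval_sim okg leg); case: ifP => _; first exact: (IH1 m) (env_ok_leq (leq_maxl _ _) okm) _ _ _.
  exact: (IH2 m) (env_ok_leq (leq_maxr _ _) okm) _ _ _.
set m' := maxn m (tbound r m); rewrite [rbound _ _]/= -/m' geq_max => /andP[m'M leR] hu su /=.
have [/andP[cm mM] b rB he se] := ok.
have ler : (tbound r m <= M)%N by apply: leq_trans m'M; apply: leq_maxr.
have okr : env_ok m (tdepth r) th e by apply: env_ok_leq ok => /=; apply: leqW; apply: leq_maxl.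
have ok' : env_ok m (rdepth R).+1 th e by apply: env_ok_leq ok => /=; rewrite ltnS; apply: leq_maxr.
have r1 : room M I J (#|th| + M) by have := env_ok_room (n := 1) isT ok; rewrite mul1n.
have sr : supp (dom th) (evalI e r) by apply: env_ok_supp okr.
have hr : hsupp m' (evalI e r).
  by apply: hsupp_leq (leq_maxr _ _) _; apply: (eval_hsupp (c := c)).
have er : evalJ (map_tuple (T th) e) r = T th (evalI e r) by apply: eval_sim okr ler.
have key th2 y : th \subset th2 -> pbij th2 -> (#|th2| <= #|th| + M)%N ->
    y \in elts (evalI e r) -> supp (dom th2) y ->
    (map_update (T th) u \in updates (@complete_graph J) sJ
        (cons_tuple (T th2 y) (map_tuple (T th) e)) R) =
    (u \in updates (@complete_graph I) sI (cons_tuple y e) R).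
  move=> s2 b2 c2 yr sy.
  have [||ok2 <-] := env_ok_cons (m' := m') ok' s2 b2 _ _ (hsupp_elts yr hr) sy.
  - by apply: leq_trans c2 _; rewrite leq_add2l leq_pmull.
  - by rewrite leq_maxl m'M.
  have r2 : room M I J #|th2| by apply: room_leq r1.
  rewrite -(IH m' th2) //; last by move=> x /su; apply: supp_sub; apply: dom_sub.
  (* The components of [u] are already supported by [dom th], so the pairs added for the bound
     variable do not affect their images. *)
  suff -> : map_update (T th) u = map_update (T th2) u by [].
  rewrite /map_update /map_location; congr (_, _, _).
    by apply/esym/transfer_map_up => // x xu; apply: su; rewrite inE xu orbT.
  by apply/esym/transfer_up => //; apply: su; apply: mem_head.
rewrite er; apply/bigfcupP/bigfcupP => -[z]; rewrite andbT => zr uz.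
  have [th2 [y [[s2 b2 c2] [sy yr ezy]]]] := elts_transfer_up r1 b sr zr.
  by exists y; rewrite ?andbT // -(key th2) // ezy.
have [th2 [s2 b2 c2 sy]] := extend_supp (room_cod r1) b (hsupp_leq m'M (hsupp_elts zr hr)).
have r2 : room M I J #|th2| by apply: room_leq r1.
exists (T th2 z); last by rewrite key.
rewrite andbT -(transfer_up s2 r2 b2 sr) transfer_mem //.
- exact: hsupp_leq m'M (hsupp_elts zr hr).
- by apply: supp_sub sr; apply: dom_sub.
- exact: hsupp_leq m'M hr.
Qed.

End Simulation.

(** * Runs *)

Section Firing.
Variables (F P : vocab) (I : finType).
Implicit Types (st : state F P I) (D : {fset update F P I}).

Lemma consistentP D :
  reflect {in D &, forall u v, u.1 = v.1 -> u.2 = v.2} (consistent D).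
Proof.
apply: (iffP allrelP) => H u v uD vD; last by apply/implyP => /eqP /(H u v uD vD) ->.
by move=> e; have := H u v uD vD; rewrite e eqxx => /eqP.
Qed.

(** [fire] takes the first listed value for a location; consistency makes this choice immaterial. *)
Lemma fire_in st D l v : consistent D -> ((l, v) : update F P I) \in D -> fire st D l = v.
Proof.
move=> /consistentP cD lD; rewrite /fire fsfunE.
have -> : l \in finsupp st `|` [fset u.1 | u in D].
  by rewrite inE; apply/orP; right; apply/imfsetP; exists (l, v).
have : v \in [seq u.2 | u <- D & u.1 == l].
  by apply/mapP; exists (l, v) => //; rewrite mem_filter eqxx.
case E : [seq _ | _ <- _ & _] => [|w ws] //= _.
have : w \in [seq u.2 | u <- D & u.1 == l] by rewrite E mem_head.
case/mapP => -[l' w']; rewrite mem_filter /= => /andP[/eqP -> wD] ->.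
exact: (cD _ _ wD lD).
Qed.

Lemma fire_out st D l : (forall v, ((l, v) : update F P I) \notin D) -> fire st D l = st l.
Proof.
move=> lD; rewrite /fire fsfunE.
have -> : [seq u.2 | u <- D & u.1 == l] = [::].
  apply/nilP; rewrite /nilp size_map size_filter -leqn0 leqNgt -has_count.
  by apply/hasPn => -[l' v] lv /=; apply: contraNneq (lD v) => <-.
by case: ifP => // /negbT; rewrite inE negb_or => /andP[/fsfun_dflt -> _].
Qed.

End Firing.

Section Steps.
Variables (F P : vocab) (R : rule digraph_vocab F P 0).

Lemma map_tuple0 (I J : choiceType) (f : hf I -> hf J) : map_tuple f [tuple] = [tuple].
Proof. exact: tuple0. Qed.

Lemma step_equivariant (I : finType) (st : state F P I) :
  equivariant st -> equivariant (step (@complete_graph I) R st).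
Proof.
move=> eq_st s l; rewrite /step; set D := updates _ _ _ _.
have mD u : (map_update (hfmap s) u \in D) = (u \in D).
  by have := updates_equivariant s eq_st R [tuple] u; rewrite map_tuple0.
case: ifP => cD //.
have [/hasP[[l' v] vD /= /eqP el]|/hasPn no] := boolP (has (fun u : update F P I => u.1 == l) D).
  subst l'; rewrite (fire_in _ cD vD); apply: fire_in => //.
  by have := mD (l, v); rewrite vD.
rewrite !fire_out ?eq_st // => v; first by apply/negP => /no /=; rewrite eqxx.
rewrite -[v](hfmapKV s); have -> := mD (l, hfmap s^-1%g v).
by apply/negP => /no /=; rewrite eqxx.
Qed.

Lemma init_equivariant (I : finType) : equivariant (init_state F P I).
Proof. by move=> s l; rewrite !fsfun_dflt ?hfmap_hf0 // finsupp0. Qed.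

Lemma run_equivariant (I : finType) i : equivariant (run (@complete_graph I) R i).
Proof. by elim: i => [|i]; [apply: init_equivariant|apply: step_equivariant]. Qed.

Lemma in_tc_trans (I : choiceType) (x y z : hf I) : in_tc x y -> in_tc y z -> in_tc x z.
Proof. by move=> xy; elim=> // w t wt _; apply: in_tc_step. Qed.

Lemma in_tc_hfmap (I : finType) (s : {perm I}) (x y : hf I) :
  in_tc x y -> in_tc (hfmap s x) (hfmap s y).
Proof.
elim=> [|z t zt _]; first exact: in_tc_refl.
by apply: in_tc_step; rewrite mem_elts_hfmap.
Qed.

Lemma active_hfmap (I : finType) (st : state F P I) (s : {perm I}) x :
  equivariant st -> active st x -> active st (hfmap s x).
Proof.
move=> eq_st [y cy xy]; exists (hfmap s y); last exact: in_tc_hfmap.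
have fin l : l \in finsupp st -> (map_location (hfmap s) l : location F P I) \in finsupp st.
  rewrite !mem_finsupp eq_st; apply: contraNneq => e.
  by apply/eqP/(@hfmap_inj _ s); rewrite e hfmap_hf0.
case: cy => [a|b|l lf|l z lf zl].
- by rewrite hfmap_atom; apply: critical_atom.
- by rewrite hfmap_hfbool; apply: critical_bool.
- by rewrite -eq_st; apply: critical_val; apply: fin.
- by apply: critical_arg (fin _ lf) _; apply: map_f.
Qed.

Lemma active_elts (I : finType) (st : state F P I) (x y : hf I) :
  active st x -> y \in elts x -> active st y.
Proof.
move=> [z cz xz] yx; exists z => //; apply: in_tc_trans xz.
exact: in_tc_step yx (in_tc_refl _).
Qed.

(** Everything in the transitive closure of a stored value is active, and unassigned locations hold
    the default 0, which has empty support. *)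
Lemma active_state_hsupp (I : finType) (st : state F P I) c :
  (forall x, active st x -> msupp c x) -> forall l, hsupp c (st l).
Proof.
move=> H l; have [lf|/fsfun_dflt ->] := boolP (l \in finsupp st); last exact: hsupp_hf0.
by move=> x xl; apply: H; exists (st l) => //; apply: critical_val.
Qed.

Lemma cover_list (I J : finType) M (th : {set I * J}) (xs : seq (hf I)) :
    pbij th -> (#|th| + size xs * M <= #|J|)%N -> (forall x, x \in xs -> hsupp M x) ->
  exists th' : {set I * J}, [/\ pbij (th :|: th'), (#|th'| <= size xs * M)%N &
                  forall x, x \in xs -> supp (dom th') x].
Proof.
move=> b le hx; have [|S cS sS] := @common_supp I M xs; first by move=> x /hx/hsupp_msupp.
have [|th' [b' d' c']] := pbij_cover_dom (S := S) b.
  by apply: leq_trans le; rewrite leq_add2l.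
by exists th'; rewrite c' d'.
Qed.

Variables (M c a : nat) (I J : finType).
Hypothesis a_max : forall f : F + P, (location_arity f <= a)%N.
Hypotheses (c_le : (c <= M)%N) (R_le : (rbound R c <= M)%N).
(** [a * M] atoms support the arguments of a location; the margin [3 * M] serves the extensions made
    by set operations and the two values compared in a consistency check. [D] adds [2 * M] per
    nested binder of the rule. *)
Let B := ((a + 3) * M)%N.
Let D := (2 * M * rdepth R + B)%N.
Hypothesis roomy : room M I J ((a + 3) * M + D).
Local Notation T := (transfer M).

(* Locations have at most [a] arguments, so any [th] may be replaced by one of
   size at most [a * M]. *)
Lemma state_sim_small (sI : state F P I) (sJ : state F P J) :
    equivariant sI -> (forall l, hsupp c (sI l)) ->
    (forall (th : {set I * J}) (l : (F + P) * seq (hf I)), (#|th| <= a * M)%N -> pbij th ->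
       size l.2 = location_arity l.1 ->
       (forall x, x \in l.2 -> hsupp M x) -> (forall x, x \in l.2 -> supp (dom th) x) ->
       sJ (map_location (T th) l) = T th (sI l)) ->
  state_sim M B sI sJ.
Proof.
move=> eqI bI H th l r b szl hl sl.
have sz : (size l.2 * M <= a * M)%N by rewrite leq_mul2r szl a_max orbT.
have leB : (a * M + M <= B)%N by rewrite /B mulnDl leq_add2l leq_pmull.
have [|th' [b' c' s']] := cover_list b _ hl.
  apply: leq_trans (room_cod r); rewrite leq_add2l (leq_trans sz) //.
  by apply: leq_trans leB; apply: leq_addr.
have c'' : (#|th'| <= a * M)%N by apply: leq_trans sz.
have le : (#|th| + #|th'| + M <= #|I|)%N.
  rewrite roomC in r; apply: leq_trans (room_cod r); rewrite -addnA leq_add2l.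
  by apply: leq_trans leB; rewrite leq_add2r.
have M1 : (1 < M)%N by case/andP: r.
have -> : map_location (T th) l = map_location (T th') l.
  by congr (_, _); apply/eq_in_map => x xl; apply: transfer_eq; rewrite ?sl ?s'.
rewrite H //; last exact: pbijUr b'.
by apply/esym/transfer_eq => //; apply: state_supp.
Qed.

Section OneStep.
Variables (sI : state F P I) (sJ : state F P J).
Hypotheses (eqI : equivariant sI) (eqJ : equivariant sJ).
Hypotheses (bI : forall l, hsupp c (sI l)) (bJ : forall l, hsupp c (sJ l)).
Hypothesis sim : state_sim M B sI sJ.
Let DI := updates (@complete_graph I) sI [tuple] R.
Let DJ := updates (@complete_graph J) sJ [tuple] R.

Lemma leq_3M_B : (3 * M <= B)%N.
Proof. by rewrite leq_mul2r leq_addl orbT. Qed.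

Lemma mem_updates_sim (th : {set I * J}) u :
    (#|th| <= (a + 3) * M)%N -> pbij th ->
    (forall x, x \in u.2 :: u.1.2 -> hsupp M x) ->
    (forall x, x \in u.2 :: u.1.2 -> supp (dom th) x) ->
  (map_update (T th) u \in DJ) = (u \in DI).
Proof.
move=> le b hu su; rewrite /DJ -(map_tuple0 (T th)).
apply: (updates_sim eqI eqJ bI bJ leq_3M_B sim (m := c)) => //; split=> //.
  by rewrite leqnn.
by apply: room_leq roomy; rewrite leq_add2r.
Qed.

Lemma updates_size_hsupp (I' : finType) (st : state F P I') u :
    equivariant st -> (forall l, hsupp c (st l)) ->
    u \in updates (@complete_graph I') st [tuple] R ->
  (size u.1.2 <= a)%N /\ forall x, x \in u.2 :: u.1.2 -> hsupp M x.
Proof.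
move=> eq_st b_st uD; have [//|sz hx hv] := updates_hsupp eq_st b_st (leqnn c) _ uD.
split; first by rewrite sz.
by move=> x; rewrite inE => /predU1P[->|/hx h]; [apply: hsupp_leq R_le hv|apply: hsupp_leq R_le h].
Qed.

Lemma pbij0 : pbij (set0 : {set I * J}).
Proof. by apply/pbijP => i j i' j'; rewrite inE. Qed.

Lemma cover_room n : (n <= a + 3)%N -> (n * M <= #|I|)%N /\ (n * M <= #|J|)%N.
Proof.
move=> le; have := roomy; rewrite roomC => /room_cod leI; have := room_cod roomy => leJ.
have le' : (n * M <= (a + 3) * M + D)%N.
  by apply: leq_trans (leq_addr _ _); rewrite leq_mul2r le orbT.
by split; apply: leq_trans le' _.
Qed.

(** A conflict involves one location and two values, at most [a + 2] sets, so a single partial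
    bijection covers it. A conflicting pair over [J] is pulled back along the inverse, one over [I]
    is pushed forward. *)
Lemma consistent_sim : consistent DI = consistent DJ.
Proof.
apply/consistentP/consistentP => H u v uD vD e.
  have [szu hu] := updates_size_hsupp eqJ bJ uD; have [szv hv] := updates_size_hsupp eqJ bJ vD.
  pose ys := v.2 :: u.2 :: u.1.2.
  have szy : (size ys <= a + 3)%N by rewrite /= -addn2 leq_add.
  have hy y : y \in ys -> hsupp M y.
    by rewrite inE => /predU1P[->|/hu] //; apply: hv; apply: mem_head.
  have b0 : pbij (pinv (set0 : {set I * J})) by rewrite pbij_pinv pbij0.
  have [|th [b le sy]] := cover_list b0 _ hy.
    by rewrite card_pinv cards0; apply: (cover_room szy).1.
  have {}b := pbijUr b.
  have le' : (#|th| <= (a + 3) * M)%N by apply: leq_trans le _; rewrite leq_mul2r szy orbT.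
  have r : room M J I #|th|.
    by rewrite roomC; apply: room_leq roomy; apply: leq_trans le' (leq_addr _ _).
  have K y : y \in ys -> T (pinv th) (T th y) = y.
    by move=> yy; apply: transferK => //; (exact: sy || exact: hy).
  have good y : y \in ys -> hsupp M (T th y) /\ supp (dom (pinv th)) (T th y).
    move=> yy; split; last by rewrite dom_pinv transfer_supp.
    by apply: transfer_hsupp => //; (exact: sy || exact: hy).
  have lift w : (forall x, x \in w.2 :: w.1.2 -> x \in ys) -> w \in DJ ->
      map_update (T th) w \in DI.
    move=> wys wD; rewrite -(@mem_updates_sim (pinv th)) ?card_pinv ?pbij_pinv //=.
    - rewrite /map_update /map_location /= K; last by apply: wys; apply: mem_head.
      rewrite -map_comp (map_id_in (f := _ \o _)); first by case: w wD {wys} => [[? ?] ?].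
      by move=> x xw; apply: K; apply: wys; rewrite inE xw orbT.
    - move=> x; rewrite -(map_cons (T th)) => /mapP[z zw ->].
      exact: (good z (wys z zw)).1.
    - move=> x; rewrite -(map_cons (T th)) => /mapP[z zw ->].
      exact: (good z (wys z zw)).2.
  have uys x : x \in u.2 :: u.1.2 -> x \in ys by move=> xu; rewrite inE xu orbT.
  have vys x : x \in v.2 :: v.1.2 -> x \in ys.
    by rewrite -e !inE => /orP[->|->]; rewrite ?orbT.
  have := H _ _ (lift u uys uD) (lift v vys vD); rewrite /= e => /(_ erefl) ev.
  rewrite -(K u.2) ?ev ?K //; first by apply: vys; apply: mem_head.
  by apply: uys; apply: mem_head.
have [szu hu] := updates_size_hsupp eqI bI uD; have [szv hv] := updates_size_hsupp eqI bI vD.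
pose xs := v.2 :: u.2 :: u.1.2.
have szx : (size xs <= a + 3)%N by rewrite /= -addn2 leq_add.
have hx x : x \in xs -> hsupp M x.
  by rewrite inE => /predU1P[->|/hu] //; apply: hv; apply: mem_head.
have [|th [b le sx]] := cover_list pbij0 _ hx.
  by rewrite cards0; apply: (cover_room szx).2.
have {}b := pbijUr b.
have le' : (#|th| <= (a + 3) * M)%N by apply: leq_trans le _; rewrite leq_mul2r szx orbT.
have r : room M I J #|th| by apply: room_leq roomy; apply: leq_trans le' (leq_addr _ _).
have ud : map_update (T th) u \in DJ.
  by rewrite mem_updates_sim // => x xu; apply: sx; rewrite inE xu orbT.
have vd : map_update (T th) v \in DJ.
  rewrite mem_updates_sim // => x; rewrite -e inE => /predU1P[->|xu]; apply: sx.
    exact: mem_head.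
  by rewrite !inE xu !orbT.
have := H _ _ ud vd; rewrite /= e => /(_ erefl).
by apply: (transfer_inj r b); rewrite ?sx ?inE ?eqxx ?orbT //; apply: hx; rewrite !inE eqxx ?orbT.
Qed.

(** The same reserve [B] appears before and after the step: by [state_sim_small] only partial
    bijections of size at most [a * M] need be considered, which leaves the atoms needed to evaluate
    the rule. Thus nothing is lost over many steps. *)
Lemma step_sim :
    (forall l, hsupp c (step (@complete_graph I) R sI l)) ->
  state_sim M B (step (@complete_graph I) R sI) (step (@complete_graph J) R sJ).
Proof.
move=> bI'; have eqI' := step_equivariant eqI; apply: state_sim_small => //.
move: eqI' bI'; rewrite /step -/DI -/DJ -consistent_sim; case: ifP => cD eqI' bI'; last first.
  move=> th l le b; apply: sim => //; apply: room_leq roomy; apply: leq_add.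
    by apply: leq_trans le _; rewrite leq_mul2r leq_addr orbT.
  exact: leq_addl.
have cD' : consistent DJ by rewrite -consistent_sim.
move=> th l le b szl hl sl.
have le3 : (#|th| <= (a + 3) * M)%N by apply: leq_trans le _; rewrite leq_mul2r leq_addr orbT.
have le3' : (#|th| + M <= (a + 3) * M)%N.
  by rewrite mulnDl leq_add // leq_pmull.
have [/hasP[[l' v] vD /= /eqP el]|/hasPn no] := boolP (has (fun u : update F P I => u.1 == l) DI).
  subst l'; have fv := fire_in sI cD vD; rewrite fv; apply: fire_in => //.
  have sv : supp (dom th) v by rewrite -fv; apply: state_supp.
  rewrite -[(_, _)]/(map_update (T th) (l, v)) mem_updates_sim //= => x.
    by rewrite inE => /predU1P[->|/hl] //; apply: (updates_size_hsupp eqI bI vD).2; apply: mem_head.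
  by rewrite inE => /predU1P[->|/sl].
have outI v : (l, v) \notin DI by apply/negP => /no /=; rewrite eqxx.
rewrite !fire_out //.
  apply: sim => //; apply: room_leq roomy; apply: leq_add => //; exact: leq_addl.
(* An update over [J] at a location untouched over [I] is impossible: the back move makes [w] the
   image of some [v], and the update would pull back to one in [DI]. *)
move=> w; apply/negP => wD.
have hw : hsupp M w by apply: (updates_size_hsupp eqJ bJ wD).2; apply: mem_head.
have r : room M I J (#|th| + M) by apply: room_leq roomy; apply: leq_trans le3' (leq_addr _ _).
have [th' [v [[sth b' c'] [sv hv ev]]]] := extend_surj (leqnn M) r b hw.
have r' : room M I J #|th'| by apply: room_leq r.
case/negP: (outI v); rewrite -(@mem_updates_sim th') //=.
- rewrite /map_update /map_location /= ev.
  by rewrite (transfer_map_up sth r' b' sl).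
- exact: leq_trans c' le3'.
- by move=> x; rewrite inE => /predU1P[->|/hl].
- by move=> x; rewrite inE => /predU1P[->|/sl] //; apply: supp_sub; apply: dom_sub.
Qed.

End OneStep.

Lemma init_sim : state_sim M B (init_state F P I) (init_state F P J).
Proof.
move=> th l r b _ _ _; rewrite !fsfun_dflt ?finsupp0 // transfer_hf0 //.
apply: room_leq r; rewrite leq_add2l; apply: leq_trans leq_3M_B.
by rewrite leq_pmull.
Qed.

Lemma run_sim i :
    (forall j l, (j <= i)%N -> hsupp c (run (@complete_graph I) R j l)) ->
    (forall j l, (j <= i)%N -> hsupp c (run (@complete_graph J) R j l)) ->
  state_sim M B (run (@complete_graph I) R i) (run (@complete_graph J) R i).
Proof.
elim: i => [|i IH] hI hJ; first exact: init_sim.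
apply: step_sim; try exact: run_equivariant.
- by move=> l; apply: hI.
- by move=> l; apply: hJ.
- by apply: IH => j l ji; [apply: hI|apply: hJ]; apply: leqW.
- by move=> l; apply: (hI i.+1).
Qed.

End Steps.

(** * Determinant of the complete graph *)

Section DeterminantParity.
Import GRing.Theory.
Local Open Scope ring_scope.

(** Let U be the all-ones matrix, so that U * U = n U. For even n, the square of U - 1 is the
    identity because n = 2 = 0 in the field, so the determinant is nonzero, hence 1. For odd n, the
    all-ones vector is in the kernel. *)
Lemma det_complete_graph (I : finType) :
  (0 < #|I|)%N -> det_query (@complete_graph I) = ~~ odd #|I|.
Proof.
rewrite /det_query /idet; set N := (\matrix_(i, j) _); move=> n0.
have NE : N = const_mx 1 - 1%:M.
  apply/matrixP => i j; rewrite !mxE /adj_mod2 /edge /complete_graph /=.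
  rewrite !(tnth_nth (enum_val i)) /= (inj_eq enum_val_inj).
  by case: eqP => _ /=; rewrite ?subrr ?subr0.
have two0 : (2%:R : 'F_2) = 0 by apply/eqP.
have nE : (#|I|%:R : 'F_2) = (odd #|I|)%:R.
  by rewrite -[in LHS](odd_double_half #|I|) natrD -mul2n natrM two0 mul0r addr0.
case: (odd #|I|) nE => /= nE; last first.
  have NN : N *m N = 1%:M.
    rewrite NE mulmxBl !mulmxBr !mul1mx mulmx1.
    have -> : (const_mx 1 : 'M_#|I|) *m const_mx 1 = (0 : 'M['F_2]_#|I|).
      apply/matrixP => i j; rewrite !mxE (eq_bigr (fun=> 1)); last by move=> k _; rewrite !mxE mul1r.
      by rewrite sumr_const card_ord nE.
    rewrite sub0r opprB addrC -addrA -opprD.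
    have -> : const_mx 1 + const_mx 1 = (0 : 'M['F_2]_#|I|).
      by apply/matrixP => i j; rewrite !mxE; apply/eqP.
    by rewrite subr0.
  have := congr1 determinant NN; rewrite det_mulmx det1.
  by case: (\det N) => -[|[|k]] // ? /eqP.
apply/negbTE/eqP => dN.
have uN : N \in unitmx by rewrite unitmxE dN unitr1.
have : N *m (const_mx 1 : 'cV_#|I|) = 0.
  rewrite NE mulmxBl mul1mx; apply/matrixP => i j; rewrite !mxE (eq_bigr (fun=> 1)).
    by rewrite sumr_const card_ord nE subrr.
  by move=> k _; rewrite !mxE mul1r.
move/(congr1 (mulmx (invmx N))); rewrite mulKmx // mulmx0 => /matrixP/(_ (Ordinal n0) ord0)/eqP.
by rewrite !mxE oner_eq0.
Qed.

End DeterminantParity.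

(** * Indistinguishability of the two complete graphs *)

(** Both bounds are chosen before the input, so the same [c] and [N] serve the two complete
    graphs. *)
Lemma answers_hsupp (V : bounded_program digraph_vocab) :
  exists c N, forall (I : finType) m (X : {fset hf I}), (N <= #|I|)%N ->
    (#|` X| <= (active_bound V).[#|I|]%R)%N ->
    (forall i x, (i <= m)%N -> active (run (@complete_graph I) (body V) i) x -> x \in X) ->
  forall i l, (i <= m)%N -> hsupp c (run (@complete_graph I) (body V) i l).
Proof.
have [c [N H]] := bounded_family_msupp (active_bound V).
exists c.+1, N => I m X leN leX aX i l im; apply: active_state_hsupp.
apply: (H I _ X leN leX) => [x|s x|x y].
- exact: aX.
- by apply: active_hfmap; apply: run_equivariant.
- exact: active_elts.
Qed.

Theorem mainTheorem9 : ~ CPTime det_query.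
Proof.
move=> [V decV]; have [c [N hN]] := answers_hsupp V.
pose F := dynfun V; pose P := dynrel V.
pose a := maxn (\max_(f : F) arity f) (\max_(p : P) arity p).
(* [room] needs [M] above 1; the other arguments bound the supports in a state and those in the
   updates produced from it. *)
pose M := maxn 2 (maxn c (rbound (body V) c)).
pose B := ((a + 3) * M)%N; pose D := (2 * M * rdepth (body V) + B)%N.
(* Doubling makes [n] even, so the determinants for [n] and [n.+1] differ; the summands secure the
   counting threshold and the space demanded by [room]. *)
pose n := (N + 5 * M + ((a + 3) * M + D + 4 * M)).*2.
have a_max (f : F + P) : (location_arity f <= a)%N.
  case: f => [f|p] /=; rewrite leq_max.
    by rewrite (leq_bigmax (F := fun f : F => arity f)).
  by rewrite (leq_bigmax (F := fun p : P => arity p)) orbT.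
have c_le : (c <= M)%N by rewrite /M !leq_max leqnn orbT.
have R_le : (rbound (body V) c <= M)%N by rewrite /M !leq_max leqnn !orbT.
have M1 : (1 < M)%N by rewrite leq_max.
have roomy : room M 'I_n 'I_n.+1 ((a + 3) * M + D).
  by rewrite /room !card_ord M1 /n -addnn; lia.
pose I := 'I_n : finType; pose J := 'I_n.+1 : finType.
have nI : (N <= #|I|)%N by rewrite card_ord /n -addnn; lia.
have nJ : (N <= #|J|)%N by rewrite card_ord /n -addnn; lia.
have detI : det_query (@complete_graph I) = true.
  rewrite det_complete_graph card_ord ?odd_double //.
  by rewrite /n -addnn; lia.
have detJ : det_query (@complete_graph J) = false.
  by rewrite det_complete_graph card_ord //= odd_double.
have := decV I (@complete_graph I); rewrite detI => -[mI [_ haltI nhaltI [XI cXI aXI] outI]].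
have := decV J (@complete_graph J); rewrite detJ => -[mJ [_ haltJ nhaltJ [XJ cXJ aXJ] outJ]].
have bI := hN I mI XI nI cXI aXI; have bJ := hN J mJ XJ nJ cXJ aXJ.
have r0 : room M I J (#|(set0 : {set I * J})| + B).
  by rewrite cards0; apply: room_leq roomy; rewrite /D addnA; apply: leq_addl.
have r1 : room M I J (#|(set0 : {set I * J})| + M).
  by apply: room_leq r0; rewrite leq_add2l leq_pmull // addn3.
(* The runs are compared only up to both halting times, as the active elements are bounded only
   until then. A nullary location contains no atoms, so the empty partial bijection suffices to read
   it. *)
have same i (p : P) b : (i <= mI)%N -> (i <= mJ)%N -> arity p = 0 ->
    run (@complete_graph I) (body V) i (inr p, [::]) = hfbool I b <->
    run (@complete_graph J) (body V) i (inr p, [::]) = hfbool J b.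
  move=> iI iJ ap.
  have sim : state_sim M B (run (@complete_graph I) (body V) i) (run (@complete_graph J) (body V) i).
    apply: (run_sim a_max c_le R_le roomy) => j l ji.
      by apply: bI; apply: leq_trans ji iI.
    by apply: bJ; apply: leq_trans ji iJ.
  have := sim set0 (inr p, [::]) r0 (pbij0 I J); rewrite /map_location /= ap => ->; try by [].
  rewrite -(transfer_hfbool b r1 (pbij0 I J)); split=> [-> //|].
  apply: transfer_inj (pbij0 I J) _ _ _ _.
  - by apply: room_leq r1; apply: leq_addr.
  - by apply: state_supp => //; apply: run_equivariant.
  - by apply: hsupp_leq c_le _; apply: bI.
  - exact: supp_hfbool.
  - exact: hsupp_hfbool.
(* If one run halted strictly earlier, [same] would make Halt true in the other run at that step,
   before its first halting time. *)
have em : mI = mJ.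
  apply/eqP; case: ltngtP => // lt.
    by case: (nhaltJ _ lt); apply/(same _ _ true); rewrite ?arity_Halt // ltnW.
  by case: (nhaltI _ lt); apply/(same _ _ true); rewrite ?arity_Halt // ltnW.
subst mJ; have /(same _ _ true (leqnn _) (leqnn _) (arity_Output V)) := outI.
by rewrite outJ => /hfbool_inj.
Qed.
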